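(* Let $P\colon \mathcal{C}^{\mathrm{op}}\to \mathsf{InfSl}$ be an $\exists$-supercompactifiable tripos (i.e. a full tripos that is $\exists$-supercompactifiable), and let $P^{\exists}$ be its full existential completion. Then there exists a Lawvere–Tierney topology $j$ on the topos $\mathsf{T}_{P^{\exists}}$ such that $\mathsf{T}_{P}\equiv \mathsf{Sh}_j(\mathsf{T}_{P^{\exists}})$, i.e. $\mathsf{T}_P$ is equivalent to the category of $j$-sheaves on $\mathsf{T}_{P^{\exists}}$.
   Context: A lex primary doctrine is a functor $P\colon \mathcal{C}^{\mathrm{op}}\to\mathsf{InfSl}$, where $\mathcal{C}$ has finite limits and $\mathsf{InfSl}$ is the category of inf-semilattices (posets with finite meets, including top) and their homomorphisms. For $f\colon A\to B$ write $P_f\colon P(B)\to P(A)$. $P$ is full existential if for every arrow $f$ of $\mathcal{C}$ the map $P_f$ has a left adjoint $\exists_f$, satisfying Beck–Chevalley (for pullback squares) and Frobenius reciprocity. $P$ is a full first-order hyperdoctrine if it is full existential, each $P(A)$ is a Heyting algebra, each $P_f$ is a Heyting algebra homomorphism, and each $P_f$ also has a right adjoint $\forall_f$, these satisfying Beck–Chevalley. $P$ has weak power objects if for every object $X$ there are an object $\mathrm{P}X$ and $\in_X\in P(X\times\mathrm{P}X)$ such that for every $Y$ and $\beta\in P(X\times Y)$ there is an arrow $\{\beta\}_X\colon Y\to\mathrm{P}X$ with $\beta=P_{\mathrm{id}_X\times\{\beta\}_X}(\in_X)$. A full tripos is a full first-order hyperdoctrine with weak power objects. Category of points $\mathcal{G}_P$: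 objects are pairs $(A,\alpha)$ with $\alpha\in P(A)$; arrows $(A,\alpha)\to(B,\beta)$ are arrows $f\colon A\to B$ of $\mathcal{C}$ with $\alpha\le P_f(\beta)$. It has finite limits. Weak dependent products: a weak dependent product of $f\colon X\to J$ along $g\colon J\to I$ consists of an arrow $h\colon Z\to I$ and an arrow $e\colon E\to X$, where $E$ is the pullback of $g$ and $h$, such that $fe$ is the projection $E\to J$, and such that for any other such data $h'\colon Z'\to I$, $e'\colon E'\to X$ (with $E'$ the pullback of $g$ and $h'$, and $fe'$ the projection $E'\to J$) there is $w\colon Z'\to Z$ with $h'=hw$ and $e'=ek$, where $k\colon E'\to E$ is induced by $w$. Generic proof: an arrow $\theta\colon\Theta\to\Lambda$ such that for every arrow $f\colon Y\to X$ there is $\upsilon_f\colon X\to\Lambda$ such that $f$ factors through the pullback $\upsilon_f^*\theta$ of $\theta$ along $\upsilon_f$ and $\upsilon_f^*\theta$ factors through $f$. A lex primary doctrine $P$ is $\exists$-supercompactifiable if $\mathcal{G}_P$ has weak dependent products (for all composable pairs) and a generic proof. It is known (and part of the paper) that in this case $P^\exists$ is a full tripos. Full existential completion $P^{\exists}$: $P^{\exists}(A)$ is the poset reflection of the preorder of pairs $(B\xrightarrow{f}A,\alpha)$ with $\alpha\in P(B)$, where $(B\xrightarrow{f}A,\alpha)\le(C\xrightarrow{g}A,\beta)$ iff there is $h\colon B\to C$ with $f=gh$ and $\alpha\le P_h(\beta)$; for $f\colon A\to B$, $P^{\exists}_f(C\xrightarrow{g}B,\beta):=(D\xrightarrow{f^*g}A,P_{g^*f}(\beta))$,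 with $D$ the pullback of $f$ and $g$ and projections $f^*g\colon D\to A$, $g^*f\colon D\to C$. Tripos-to-topos construction $\mathsf{T}_R$ of a full existential doctrine $R$: objects are pairs $(A,\rho)$ with $\rho\in R(A\times A)$ such that $\rho\le R_{\langle\pi_2,\pi_1\rangle}(\rho)$ and $R_{\langle\pi_1,\pi_2\rangle}(\rho)\wedge R_{\langle\pi_2,\pi_3\rangle}(\rho)\le R_{\langle\pi_1,\pi_3\rangle}(\rho)$. Arrows $(A,\rho)\to(B,\sigma)$ are $\phi\in R(A\times B)$ such that: (i) $\phi\le R_{\langle\pi_1,\pi_1\rangle}(\rho)\wedge R_{\langle\pi_2,\pi_2\rangle}(\sigma)$; (ii) $R_{\langle\pi_1,\pi_2\rangle}(\rho)\wedge R_{\langle\pi_1,\pi_3\rangle}(\phi)\le R_{\langle\pi_2,\pi_3\rangle}(\phi)$ over $A\times A\times B$; (iii) $R_{\langle\pi_2,\pi_3\rangle}(\sigma)\wedge R_{\langle\pi_1,\pi_2\rangle}(\phi)\le R_{\langle\pi_1,\pi_3\rangle}(\phi)$ over $A\times B\times B$; (iv) $R_{\langle\pi_1,\pi_2\rangle}(\phi)\wedge R_{\langle\pi_1,\pi_3\rangle}(\phi)\le R_{\langle\pi_2,\pi_3\rangle}(\sigma)$ over $A\times B\times B$; (v) $R_{\Delta_A}(\rho)\le\exists_{\pi_1}(\phi)$, with $\pi_1\colon A\times B\to A$. Composition is relational composition and the identity of $(A,\rho)$ is $\rho$. If $R$ is a full tripos then $\mathsf{T}_R$ is an elementary topos. 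*)

(* Defs.v *)
(* Neither Stdlib nor MathComp provides category theory or Heyting algebras, and
   the ordered structures of MathComp are boolean and restricted to choice types.
   Categories, doctrines, toposes and sheaves are therefore defined here, with
   Leibniz equality of arrows and Prop-valued orders.  Proof irrelevance is used
   to compare arrows that carry proofs, extensionality to form the quotient in
   the poset reflection. *)
From Stdlib Require Import FunctionalExtensionality PropExtensionality.

Set Implicit Arguments.
Unset Strict Implicit.
Unset Printing Implicit Defensive.

Record category := Category {
  Ob :> Type;
  Hom : Ob -> Ob -> Type;
  idm : forall A, Hom A A;
  comp : forall A B D, Hom B D -> Hom A B -> Hom A D;
  comp_idl : forall A B (f : Hom A B), comp (idm B) f = f;
  comp_idr : forall A B (f : Hom A B), comp f (idm A) = f;
  comp_assoc : forall A B D E (h : Hom D E) (g : Hom B D) (f : Hom A B),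
    comp h (comp g f) = comp (comp h g) f
}.
Arguments Hom {c} _ _.
Arguments idm {c} A.
Arguments comp {c A B D} _ _.

Notation "g ∘ f" := (comp g f) (at level 40, left associativity).

Definition mono (C : category) (A B : C) (m : Hom A B) : Prop :=
  forall (X : C) (u v : Hom X A), m ∘ u = m ∘ v -> u = v.

Definition is_iso (C : category) (A B : C) (f : Hom A B) : Prop :=
  exists g : Hom B A, g ∘ f = idm A /\ f ∘ g = idm B.

Definition is_pullback (C : category) (A B D E : C) (f : Hom A D) (g : Hom B D)
    (p : Hom E A) (q : Hom E B) : Prop :=
  f ∘ p = g ∘ q /\
  forall (X : C) (a : Hom X A) (b : Hom X B), f ∘ a = g ∘ b ->
    exists! u : Hom X E, p ∘ u = a /\ q ∘ u = b.

Record finite_limits (C : category) := FiniteLimits {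
  one : C;
  to_one : forall A : C, Hom A one;
  to_one_uniq : forall (A : C) (f : Hom A one), f = to_one A;
  prd : C -> C -> C;
  pi1 : forall A B : C, Hom (prd A B) A;
  pi2 : forall A B : C, Hom (prd A B) B;
  prd_pair : forall (X A B : C), Hom X A -> Hom X B -> Hom X (prd A B);
  pi1_prd_pair : forall (X A B : C) (a : Hom X A) (b : Hom X B),
    pi1 A B ∘ prd_pair a b = a;
  pi2_prd_pair : forall (X A B : C) (a : Hom X A) (b : Hom X B),
    pi2 A B ∘ prd_pair a b = b;
  prd_pair_eta : forall (X A B : C) (u : Hom X (prd A B)),
    u = prd_pair (pi1 A B ∘ u) (pi2 A B ∘ u);
  pb : forall (A B D : C), Hom A D -> Hom B D -> C;
  pb1 : forall (A B D : C) (f : Hom A D) (g : Hom B D), Hom (pb f g) A;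
  pb2 : forall (A B D : C) (f : Hom A D) (g : Hom B D), Hom (pb f g) B;
  pb_is_pullback : forall (A B D : C) (f : Hom A D) (g : Hom B D),
    is_pullback f g (pb1 f g) (pb2 f g)
}.

Record lex_category := LexCategory {
  lex_cat :> category;
  lex_lim : finite_limits lex_cat
}.

Section LexCategory.
Variable C : lex_category.

Definition lone : C := one (lex_lim C).
Definition lto_one (A : C) : Hom A lone := to_one (lex_lim C) A.
Definition lprd (A B : C) : C := prd (lex_lim C) A B.
Definition lpi1 (A B : C) : Hom (lprd A B) A := pi1 (lex_lim C) A B.
Definition lpi2 (A B : C) : Hom (lprd A B) B := pi2 (lex_lim C) A B.
Definition lpair (X A B : C) (a : Hom X A) (b : Hom X B) : Hom X (lprd A B) :=
  prd_pair (lex_lim C) a b.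
Definition lpb (A B D : C) (f : Hom A D) (g : Hom B D) : C :=
  pb (lex_lim C) f g.
Definition lpb1 (A B D : C) (f : Hom A D) (g : Hom B D) : Hom (lpb f g) A :=
  pb1 (lex_lim C) f g.
Definition lpb2 (A B D : C) (f : Hom A D) (g : Hom B D) : Hom (lpb f g) B :=
  pb2 (lex_lim C) f g.

Definition ldiag (A : C) : Hom A (lprd A A) := lpair (idm A) (idm A).
Definition lprd_map (A B A' B' : C) (f : Hom A A') (g : Hom B B') :
    Hom (lprd A B) (lprd A' B') :=
  lpair (f ∘ lpi1 A B) (g ∘ lpi2 A B).

(* Ternary products are A × (B × D). *)
Definition lprd3 (A B D : C) : C := lprd A (lprd B D).
Definition tpi1 (A B D : C) : Hom (lprd3 A B D) A := lpi1 A (lprd B D).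
Definition tpi2 (A B D : C) : Hom (lprd3 A B D) B :=
  lpi1 B D ∘ lpi2 A (lprd B D).
Definition tpi3 (A B D : C) : Hom (lprd3 A B D) D :=
  lpi2 B D ∘ lpi2 A (lprd B D).

Lemma lpi1_pair (X A B : C) (a : Hom X A) (b : Hom X B) :
  lpi1 A B ∘ lpair a b = a.
Proof. apply pi1_prd_pair. Qed.

Lemma lpi2_pair (X A B : C) (a : Hom X A) (b : Hom X B) :
  lpi2 A B ∘ lpair a b = b.
Proof. apply pi2_prd_pair. Qed.

Lemma lpair_ext (X A B : C) (u v : Hom X (lprd A B)) :
  lpi1 A B ∘ u = lpi1 A B ∘ v -> lpi2 A B ∘ u = lpi2 A B ∘ v -> u = v.
Proof.
unfold lpi1, lpi2, lprd in *. intros H1 H2.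
rewrite (@prd_pair_eta _ (lex_lim C) _ _ _ u), (@prd_pair_eta _ (lex_lim C) _ _ _ v).
rewrite H1, H2. reflexivity.
Qed.

Lemma lpair_comp (X Y A B : C) (a : Hom X A) (b : Hom X B) (k : Hom Y X) :
  lpair a b ∘ k = lpair (a ∘ k) (b ∘ k).
Proof.
apply lpair_ext; rewrite comp_assoc.
- rewrite !lpi1_pair. reflexivity.
- rewrite !lpi2_pair. reflexivity.
Qed.

Lemma lpair_eta (A B : C) : lpair (lpi1 A B) (lpi2 A B) = idm (lprd A B).
Proof.
apply lpair_ext; rewrite comp_idr.
- apply lpi1_pair.
- apply lpi2_pair.
Qed.

Lemma lpb_is_pullback (A B D : C) (f : Hom A D) (g : Hom B D) :
  is_pullback f g (lpb1 f g) (lpb2 f g).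
Proof. apply pb_is_pullback. Qed.

End LexCategory.

Record inf_semilattice := InfSemilattice {
  isl_car :> Type;
  le : isl_car -> isl_car -> Prop;
  le_refl : forall x, le x x;
  le_trans : forall x y z, le x y -> le y z -> le x z;
  le_antisym : forall x y, le x y -> le y x -> x = y;
  top : isl_car;
  meet : isl_car -> isl_car -> isl_car;
  le_top : forall x, le x top;
  meet_lel : forall x y, le (meet x y) x;
  meet_ler : forall x y, le (meet x y) y;
  meet_glb : forall x y z, le z x -> le z y -> le z (meet x y)
}.
Arguments le {i} _ _.
Arguments top {i}.
Arguments meet {i} _ _.
Arguments le_refl {i} x.
Arguments le_trans {i} [x] y [z] _ _.
Arguments le_antisym {i} [x y] _ _.

Notation "x ≤ y" := (le x y) (at level 70, no associativity).
Notation "x ⊓ y" := (meet x y) (at level 45, left associativity).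

Definition isl_hom (L M : inf_semilattice) (f : L -> M) : Prop :=
  f top = top /\ forall x y, f (x ⊓ y) = f x ⊓ f y.

Record heyting_structure (L : inf_semilattice) := HeytingStructure {
  bot : L;
  join : L -> L -> L;
  imp : L -> L -> L;
  bot_le : forall x, bot ≤ x;
  join_lub : forall x y z, join x y ≤ z <-> x ≤ z /\ y ≤ z;
  imp_adj : forall x y z, z ≤ imp x y <-> z ⊓ x ≤ y
}.

Definition heyting_hom (L M : inf_semilattice) (HL : heyting_structure L)
    (HM : heyting_structure M) (f : L -> M) : Prop :=
  isl_hom f /\ f (bot HL) = bot HM /\
  (forall x y, f (join HL x y) = join HM (f x) (f y)) /\
  (forall x y, f (imp HL x y) = imp HM (f x) (f y)).

(* reidx f is P_f, and below ex f and all f are its left and right adjoints. *)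
Record lex_primary_doctrine (C : lex_category) := LexPrimaryDoctrine {
  fib :> C -> inf_semilattice;
  reidx : forall A B : C, Hom A B -> fib B -> fib A;
  reidx_hom : forall (A B : C) (f : Hom A B), isl_hom (reidx f);
  reidx_id : forall (A : C) (x : fib A), reidx (idm A) x = x;
  reidx_comp : forall (A B D : C) (g : Hom B D) (f : Hom A B) (x : fib D),
    reidx (g ∘ f) x = reidx f (reidx g x)
}.
Arguments reidx {C} _ {A B} _ _.

Record full_existential (C : lex_category) (P : lex_primary_doctrine C) :=
  FullExistential {
  ex : forall A B : C, Hom A B -> P A -> P B;
  ex_adj : forall (A B : C) (f : Hom A B) (x : P A) (y : P B),
    ex f x ≤ y <-> x ≤ reidx P f y;
  ex_beck_chevalley : forall (A B D E : C) (f : Hom A D) (g : Hom B D)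
      (p : Hom E A) (q : Hom E B), is_pullback f g p q ->
    forall x : P A, reidx P g (ex f x) = ex q (reidx P p x);
  ex_frobenius : forall (A B : C) (f : Hom A B) (x : P A) (y : P B),
    ex f (x ⊓ reidx P f y) = ex f x ⊓ y
}.

Record full_first_order_hyperdoctrine (C : lex_category)
    (P : lex_primary_doctrine C) := FullFirstOrderHyperdoctrine {
  fo_ex :> full_existential P;
  fo_heyting : forall A : C, heyting_structure (P A);
  fo_reidx : forall (A B : C) (f : Hom A B),
    heyting_hom (fo_heyting B) (fo_heyting A) (reidx P f);
  all : forall A B : C, Hom A B -> P A -> P B;
  all_adj : forall (A B : C) (f : Hom A B) (x : P A) (y : P B),
    y ≤ all f x <-> reidx P f y ≤ x;
  all_beck_chevalley : forall (A B D E : C) (f : Hom A D) (g : Hom B D)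
      (p : Hom E A) (q : Hom E B), is_pullback f g p q ->
    forall x : P A, reidx P g (all f x) = all q (reidx P p x)
}.

Definition weak_power_objects (C : lex_category) (P : lex_primary_doctrine C) :
    Prop :=
  forall X : C, exists (PX : C) (mem : P (lprd X PX)),
    forall (Y : C) (b : P (lprd X Y)), exists c : Hom Y PX,
      b = reidx P (lprd_map (idm X) c) mem.

Record full_tripos (C : lex_category) (P : lex_primary_doctrine C) :=
  FullTripos {
  tripos_fo :> full_first_order_hyperdoctrine P;
  tripos_weak_power : weak_power_objects P
}.

Section Entailment.
Variables (C : lex_category) (P : lex_primary_doctrine C).

Lemma reidx_meet (A B : C) (f : Hom A B) (x y : P B) :
  reidx P f (x ⊓ y) = reidx P f x ⊓ reidx P f y.
Proof. apply (proj2 (reidx_hom P f)). Qed.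

Lemma reidx_top (A B : C) (f : Hom A B) : reidx P f top = top.
Proof. apply (proj1 (reidx_hom P f)). Qed.

Lemma le_meetP (L : inf_semilattice) (x y : L) : x ≤ y -> x = x ⊓ y.
Proof.
intro H. apply le_antisym.
- apply meet_glb; [apply le_refl | exact H].
- apply meet_lel.
Qed.

Lemma reidx_mono (A B : C) (f : Hom A B) (x y : P B) :
  x ≤ y -> reidx P f x ≤ reidx P f y.
Proof.
intro H. rewrite (le_meetP H), reidx_meet. apply meet_ler.
Qed.

End Entailment.

Section CategoryOfPoints.
Variables (C : lex_category) (P : lex_primary_doctrine C).

Definition pt_ob : Type := {A : C & P A}.
Definition pt_hom (X Y : pt_ob) : Type :=
  {f : Hom (projT1 X) (projT1 Y) | projT2 X ≤ reidx P f (projT2 Y)}.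

Lemma pt_hom_ext (X Y : pt_ob) (f g : pt_hom X Y) :
  proj1_sig f = proj1_sig g -> f = g.
Proof. apply eq_sig_hprop. intros. apply proof_irrelevance. Qed.

Definition pt_id (X : pt_ob) : pt_hom X X.
Proof.
exists (idm (projT1 X)). rewrite reidx_id. apply le_refl.
Defined.

Definition pt_comp (X Y Z : pt_ob) (g : pt_hom Y Z) (f : pt_hom X Y) :
  pt_hom X Z.
Proof.
exists (proj1_sig g ∘ proj1_sig f). rewrite reidx_comp.
apply (le_trans _ (proj2_sig f)). apply reidx_mono. exact (proj2_sig g).
Defined.

Definition category_of_points : category.
Proof.
apply (@Category pt_ob pt_hom pt_id pt_comp); intros; apply pt_hom_ext.
- apply comp_idl.
- apply comp_idr.
- apply comp_assoc.
Defined.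

End CategoryOfPoints.

(* p : E → J and q : E → Z are the projections of the pullback of g and h, and k
   is the arrow of pullbacks induced by w. *)
Definition is_weak_dependent_product (C : category) (X J I : C)
    (f : Hom X J) (g : Hom J I) (Z E : C) (h : Hom Z I)
    (p : Hom E J) (q : Hom E Z) (e : Hom E X) : Prop :=
  is_pullback g h p q /\ f ∘ e = p /\
  forall (Z' E' : C) (h' : Hom Z' I) (p' : Hom E' J) (q' : Hom E' Z')
      (e' : Hom E' X),
    is_pullback g h' p' q' -> f ∘ e' = p' ->
    exists w : Hom Z' Z, h' = h ∘ w /\
      exists k : Hom E' E, p ∘ k = p' /\ q ∘ k = w ∘ q' /\ e' = e ∘ k.

Definition has_weak_dependent_products (C : category) : Prop :=
  forall (X J I : C) (f : Hom X J) (g : Hom J I),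
    exists (Z E : C) (h : Hom Z I) (p : Hom E J) (q : Hom E Z) (e : Hom E X),
      is_weak_dependent_product f g h p q e.

(* p : E → X is the pullback of theta along v. *)
Definition is_generic_proof (C : category) (Th La : C) (theta : Hom Th La) :
    Prop :=
  forall (Y X : C) (f : Hom Y X),
    exists (v : Hom X La) (E : C) (p : Hom E X) (q : Hom E Th),
      is_pullback v theta p q /\
      (exists s : Hom Y E, f = p ∘ s) /\ (exists t : Hom E Y, p = f ∘ t).

Definition has_generic_proof (C : category) : Prop :=
  exists (Th La : C) (theta : Hom Th La), is_generic_proof theta.

Definition ex_supercompactifiable (C : lex_category)
    (P : lex_primary_doctrine C) : Prop :=
  has_weak_dependent_products (category_of_points P) /\
  has_generic_proof (category_of_points P).

Record meet_preorder := MeetPreorder {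
  mp_car :> Type;
  mp_le : mp_car -> mp_car -> Prop;
  mp_refl : forall x, mp_le x x;
  mp_trans : forall x y z, mp_le x y -> mp_le y z -> mp_le x z;
  mp_top : mp_car;
  mp_meet : mp_car -> mp_car -> mp_car;
  mp_le_top : forall x, mp_le x mp_top;
  mp_meet_lel : forall x y, mp_le (mp_meet x y) x;
  mp_meet_ler : forall x y, mp_le (mp_meet x y) y;
  mp_meet_glb : forall x y z, mp_le z x -> mp_le z y -> mp_le z (mp_meet x y)
}.
Arguments mp_le {m} _ _.
Arguments mp_refl {m} x.
Arguments mp_trans {m} [x] y [z] _ _.
Arguments mp_top {m}.
Arguments mp_meet {m} _ _.

(* The elements of the poset reflection are the equivalence classes of the
   preorder, as predicates on it. *)
Section PosetReflection.
Variable Q : meet_preorder.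

Definition mp_eqv (x y : Q) : Prop := mp_le x y /\ mp_le y x.

Definition refl_car : Type := {S : Q -> Prop | exists q, S = mp_eqv q}.

Definition cls (q : Q) : refl_car :=
  exist _ (mp_eqv q) (ex_intro _ q eq_refl).

Lemma cls_surj (s : refl_car) : exists q, s = cls q.
Proof.
destruct s as [S [q H]]. exists q. subst S. reflexivity.
Qed.

Lemma mp_eqv_refl (x : Q) : mp_eqv x x.
Proof. split; apply mp_refl. Qed.

Lemma mp_eqv_sym (x y : Q) : mp_eqv x y -> mp_eqv y x.
Proof. intros [H K]. split; assumption. Qed.

Lemma mp_eqv_trans (x y z : Q) : mp_eqv x y -> mp_eqv y z -> mp_eqv x z.
Proof.
intros [H K] [H' K']. split; [apply (mp_trans y) | apply (mp_trans y)]; assumption.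
Qed.

Lemma refl_ext (s t : refl_car) :
  (forall x, proj1_sig s x <-> proj1_sig t x) -> s = t.
Proof.
intro H. apply eq_sig_hprop; [intros; apply proof_irrelevance |].
apply functional_extensionality. intro x. apply propositional_extensionality.
apply H.
Qed.

Lemma cls_eq (q q' : Q) : mp_eqv q q' -> cls q = cls q'.
Proof.
intro H. apply refl_ext. intro x. simpl. split; intro K.
- exact (mp_eqv_trans (mp_eqv_sym H) K).
- exact (mp_eqv_trans H K).
Qed.

Lemma cls_inj (q q' : Q) : cls q = cls q' -> mp_eqv q q'.
Proof.
intro H. change (proj1_sig (cls q) q'). rewrite H. apply mp_eqv_refl.
Qed.

Definition refl_le (s t : refl_car) : Prop :=
  exists q q', proj1_sig s q /\ proj1_sig t q' /\ mp_le q q'.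

Lemma refl_le_cls (q q' : Q) : refl_le (cls q) (cls q') <-> mp_le q q'.
Proof.
split.
- intros (r & r' & [H _] & [_ K] & L).
  exact (mp_trans r H (mp_trans r' L K)).
- intro H. exists q, q'. repeat split; try apply mp_refl. exact H.
Qed.

Lemma refl_meet_ex (s t : refl_car) :
  exists r, (fun x => exists q q', proj1_sig s q /\ proj1_sig t q' /\
              mp_eqv (mp_meet q q') x) = mp_eqv r.
Proof.
destruct (cls_surj s) as [q ->], (cls_surj t) as [q' ->].
exists (mp_meet q q').
apply functional_extensionality. intro x. apply propositional_extensionality.
split.
- intros (r & r' & [H K] & [H' K'] & L). apply (fun h => mp_eqv_trans h L).
  split; apply mp_meet_glb.
  + exact (mp_trans q (mp_meet_lel _ _) H).
  + exact (mp_trans q' (mp_meet_ler _ _) H').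
  + exact (mp_trans r (mp_meet_lel _ _) K).
  + exact (mp_trans r' (mp_meet_ler _ _) K').
- intro H. exists q, q'. repeat split; try apply mp_refl; apply H.
Qed.

Definition refl_meet (s t : refl_car) : refl_car :=
  exist _ _ (refl_meet_ex s t).

Lemma refl_meet_cls (q q' : Q) :
  refl_meet (cls q) (cls q') = cls (mp_meet q q').
Proof.
apply refl_ext. intro x. simpl. split.
- intros (r & r' & [H K] & [H' K'] & L). apply (fun h => mp_eqv_trans h L).
  split; apply mp_meet_glb.
  + exact (mp_trans q (mp_meet_lel _ _) H).
  + exact (mp_trans q' (mp_meet_ler _ _) H').
  + exact (mp_trans r (mp_meet_lel _ _) K).
  + exact (mp_trans r' (mp_meet_ler _ _) K').
- intro H. exists q, q'. repeat split; try apply mp_refl; apply H.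
Qed.

Definition poset_reflection : inf_semilattice.
Proof.
apply (@InfSemilattice refl_car refl_le) with (top := cls mp_top)
  (meet := refl_meet).
- intro s. destruct (cls_surj s) as [q ->]. apply refl_le_cls, mp_refl.
- intros s t u. destruct (cls_surj s) as [x ->], (cls_surj t) as [y ->],
    (cls_surj u) as [z ->]. rewrite !refl_le_cls. apply mp_trans.
- intros s t. destruct (cls_surj s) as [x ->], (cls_surj t) as [y ->].
  rewrite !refl_le_cls. intros H K. apply cls_eq. split; assumption.
- intro s. destruct (cls_surj s) as [q ->]. apply refl_le_cls, mp_le_top.
- intros s t. destruct (cls_surj s) as [x ->], (cls_surj t) as [y ->].
  rewrite refl_meet_cls. apply refl_le_cls, mp_meet_lel.
- intros s t. destruct (cls_surj s) as [x ->], (cls_surj t) as [y ->].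
  rewrite refl_meet_cls. apply refl_le_cls, mp_meet_ler.
- intros s t u. destruct (cls_surj s) as [x ->], (cls_surj t) as [y ->],
    (cls_surj u) as [z ->]. rewrite refl_meet_cls, !refl_le_cls.
  apply mp_meet_glb.
Defined.

End PosetReflection.

Section Lift.
Variables (Q Q' : meet_preorder) (f : Q -> Q').
Hypothesis f_mono : forall x y, mp_le x y -> mp_le (f x) (f y).

Lemma lift_ex (s : poset_reflection Q) :
  exists r, (fun x => exists q, proj1_sig s q /\ mp_eqv (f q) x) = mp_eqv r.
Proof.
destruct (cls_surj s) as [q ->]. exists (f q).
apply functional_extensionality. intro x. apply propositional_extensionality.
split.
- intros (r & [H K] & L). apply (fun h => mp_eqv_trans h L).
  split; apply f_mono; assumption.
- intro H. exists q. split; [apply mp_eqv_refl | exact H].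
Qed.

Definition refl_lift (s : poset_reflection Q) : poset_reflection Q' :=
  exist _ _ (lift_ex s).

Lemma refl_lift_cls (q : Q) : refl_lift (cls q) = cls (f q).
Proof.
apply refl_ext. intro x. simpl. split.
- intros (r & [H K] & L). apply (fun h => mp_eqv_trans h L).
  split; apply f_mono; assumption.
- intro H. exists q. split; [apply mp_eqv_refl | exact H].
Qed.

End Lift.

Section ExistentialCompletion.
Variables (C : lex_category) (P : lex_primary_doctrine C).

(* The pairs (B → A, α ∈ P(B)); their preorder has finite meets, given by
   pullback over A. *)
Record exc_elem (A : C) := ExcElem {
  exc_dom : C;
  exc_map : Hom exc_dom A;
  exc_pred : P exc_dom
}.

Definition exc_le (A : C) (x y : exc_elem A) : Prop :=
  exists h : Hom (exc_dom x) (exc_dom y),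
    exc_map x = exc_map y ∘ h /\ exc_pred x ≤ reidx P h (exc_pred y).

Definition exc_top (A : C) : exc_elem A := ExcElem (idm A) top.

Definition exc_meet (A : C) (x y : exc_elem A) : exc_elem A :=
  ExcElem (exc_map x ∘ lpb1 (exc_map x) (exc_map y))
    (reidx P (lpb1 (exc_map x) (exc_map y)) (exc_pred x) ⊓
     reidx P (lpb2 (exc_map x) (exc_map y)) (exc_pred y)).

Definition exc_preorder (A : C) : meet_preorder.
Proof.
apply (@MeetPreorder (exc_elem A) (@exc_le A)) with (mp_top := exc_top A)
  (mp_meet := @exc_meet A).
- intro x. exists (idm _). rewrite comp_idr, reidx_id.
  split; [reflexivity | apply le_refl].
- intros x y z (h & H & K) (h' & H' & K'). exists (h' ∘ h). split.
  + rewrite H, H', comp_assoc. reflexivity.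
  + rewrite reidx_comp. apply (le_trans _ K). apply reidx_mono. exact K'.
- intro x. exists (exc_map x). split.
  + symmetry. apply comp_idl.
  + simpl. rewrite reidx_top. apply le_top.
- intros x y. exists (lpb1 _ _). split; [reflexivity | apply meet_lel].
- intros x y. exists (lpb2 _ _). split; [| apply meet_ler].
  apply (lpb_is_pullback (exc_map x) (exc_map y)).
- intros x y z (h & H & K) (h' & H' & K').
  destruct (lpb_is_pullback (exc_map x) (exc_map y)) as [_ U].
  destruct (U _ h h') as (u & [U1 U2] & _); [congruence |].
  exists u. split; simpl.
  + rewrite <- comp_assoc, U1. exact H.
  + rewrite reidx_meet, <- !reidx_comp, U1, U2. apply meet_glb; assumption.
Defined.

Definition exc_fib (A : C) : inf_semilattice := poset_reflection (exc_preorder A).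

Definition exc_reidx0 (A B : C) (f : Hom A B) (x : exc_preorder B) :
    exc_preorder A :=
  ExcElem (lpb1 f (exc_map x)) (reidx P (lpb2 f (exc_map x)) (exc_pred x)).

(* An element over A is below the reindexing of x along f is an element over
   its composite with f is below x. *)
Lemma exc_reidx0_le (A B : C) (f : Hom A B) (y : exc_elem A) (x : exc_elem B) :
  exc_le y (exc_reidx0 f x) <->
  exc_le (ExcElem (f ∘ exc_map y) (exc_pred y)) x.
Proof.
destruct (lpb_is_pullback f (exc_map x)) as [E U]. split.
- intros (h & H & K). exists (lpb2 f (exc_map x) ∘ h). simpl in *. split.
  + rewrite H, !comp_assoc, E. reflexivity.
  + rewrite reidx_comp. exact K.
- intros (h & H & K). simpl in *.
  destruct (U _ _ _ H) as (u & [U1 U2] & _). exists u. simpl. split.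
  + symmetry. exact U1.
  + rewrite <- reidx_comp, U2. exact K.
Qed.

Lemma exc_reidx0_mono (A B : C) (f : Hom A B) (x y : exc_preorder B) :
  mp_le x y -> mp_le (exc_reidx0 f x) (exc_reidx0 f y).
Proof.
intro H. apply exc_reidx0_le.
apply (mp_trans (m := exc_preorder B) x); [| exact H].
apply exc_reidx0_le. apply (mp_refl (m := exc_preorder A)).
Qed.

Definition exc_reidx (A B : C) (f : Hom A B) : exc_fib B -> exc_fib A :=
  refl_lift (@exc_reidx0_mono A B f).

Definition exc_ex0 (A B : C) (f : Hom A B) (x : exc_preorder A) :
    exc_preorder B :=
  ExcElem (f ∘ exc_map x) (exc_pred x).

Lemma exc_ex0_mono (A B : C) (f : Hom A B) (x y : exc_preorder A) :
  mp_le x y -> mp_le (exc_ex0 f x) (exc_ex0 f y).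
Proof.
intros (h & H & K). exists h. simpl. split; [| exact K].
rewrite H, comp_assoc. reflexivity.
Qed.

Definition exc_ex (A B : C) (f : Hom A B) : exc_fib A -> exc_fib B :=
  refl_lift (@exc_ex0_mono A B f).

Lemma exc_adj (A B : C) (f : Hom A B) (s : exc_fib A) (t : exc_fib B) :
  exc_ex f s ≤ t <-> s ≤ exc_reidx f t.
Proof.
destruct (cls_surj s) as [x ->], (cls_surj t) as [y ->].
unfold exc_ex, exc_reidx. rewrite !refl_lift_cls. simpl.
rewrite !refl_le_cls. symmetry. apply exc_reidx0_le.
Qed.

Lemma exc_le_ext (A : C) (s t : exc_fib A) :
  (forall u : exc_fib A, u ≤ s <-> u ≤ t) -> s = t.
Proof.
intro H. apply le_antisym; apply H; apply le_refl.
Qed.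

Lemma exc_ex_id (A : C) (s : exc_fib A) : exc_ex (idm A) s = s.
Proof.
destruct (cls_surj s) as [x ->]. unfold exc_ex. rewrite refl_lift_cls.
destruct x as [D m a]. unfold exc_ex0. simpl. rewrite comp_idl. reflexivity.
Qed.

Lemma exc_ex_comp (A B D : C) (g : Hom B D) (f : Hom A B) (s : exc_fib A) :
  exc_ex (g ∘ f) s = exc_ex g (exc_ex f s).
Proof.
destruct (cls_surj s) as [x ->]. unfold exc_ex. rewrite !refl_lift_cls.
unfold exc_ex0. simpl. rewrite comp_assoc. reflexivity.
Qed.

Lemma le_meet_iff (L : inf_semilattice) (x y z : L) :
  z ≤ x ⊓ y <-> z ≤ x /\ z ≤ y.
Proof.
split.
- intro H. split; apply (le_trans _ H); [apply meet_lel | apply meet_ler].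
- intros [H K]. apply meet_glb; assumption.
Qed.

Definition existential_completion : lex_primary_doctrine C.
Proof.
apply (@LexPrimaryDoctrine C exc_fib exc_reidx).
- intros A B f. split.
  + apply le_antisym; [apply le_top |]. apply exc_adj, le_top.
  + intros x y. apply exc_le_ext. intro u.
    rewrite le_meet_iff, <- !exc_adj, le_meet_iff. reflexivity.
- intros A x. apply exc_le_ext. intro u.
  rewrite <- exc_adj, exc_ex_id. reflexivity.
- intros A B D g f x. apply exc_le_ext. intro u.
  rewrite <- !exc_adj, exc_ex_comp. reflexivity.
Defined.

Lemma exc_beck_chevalley (A B D E : C) (f : Hom A D) (g : Hom B D)
    (p : Hom E A) (q : Hom E B) : is_pullback f g p q ->
  forall s : exc_fib A, exc_reidx g (exc_ex f s) = exc_ex q (exc_reidx p s).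
Proof.
intros [Hc U] s. destruct (cls_surj s) as [x ->].
unfold exc_ex, exc_reidx. rewrite !refl_lift_cls. apply cls_eq. split.
- destruct (lpb_is_pullback g (f ∘ exc_map x)) as [E1 _].
  destruct (lpb_is_pullback p (exc_map x)) as [E2 U2].
  destruct (U _ (exc_map x ∘ lpb2 g (f ∘ exc_map x))
              (lpb1 g (f ∘ exc_map x))) as (u & [V1 V2] & _).
  { rewrite comp_assoc. symmetry. exact E1. }
  destruct (U2 _ _ _ V1) as (w & [W1 W2] & _).
  exists w. simpl. split.
  + rewrite <- comp_assoc, W1, V2. reflexivity.
  + rewrite <- reidx_comp, W2. apply le_refl.
- apply exc_reidx0_le. exists (lpb2 p (exc_map x)). simpl.
  split; [| apply le_refl].
  destruct (lpb_is_pullback p (exc_map x)) as [E2 _].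
  rewrite comp_assoc, <- Hc, <- !comp_assoc, E2. reflexivity.
Qed.

Lemma exc_frobenius (A B : C) (f : Hom A B) (s : exc_fib A) (t : exc_fib B) :
  exc_ex f (s ⊓ exc_reidx f t) = exc_ex f s ⊓ t.
Proof.
apply le_antisym.
- apply exc_adj. change (exc_reidx f) with (reidx existential_completion f).
  rewrite reidx_meet. apply meet_glb.
  + apply (le_trans _ (meet_lel _ _)). apply exc_adj, le_refl.
  + apply meet_ler.
- destruct (cls_surj s) as [x ->], (cls_surj t) as [y ->].
  unfold exc_ex, exc_reidx. rewrite !refl_lift_cls. simpl.
  rewrite !refl_meet_cls, refl_lift_cls. apply refl_le_cls.
  set (m := f ∘ exc_map x).
  destruct (lpb_is_pullback m (exc_map y)) as [E1 _].
  destruct (lpb_is_pullback f (exc_map y)) as [E2 U2].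
  destruct (U2 _ (exc_map x ∘ lpb1 m (exc_map y)) (lpb2 m (exc_map y)))
    as (u & [V1 V2] & _).
  { rewrite comp_assoc. exact E1. }
  destruct (lpb_is_pullback (exc_map x) (lpb1 f (exc_map y))) as [E3 U3].
  destruct (U3 _ (lpb1 m (exc_map y)) u) as (w & [W1 W2] & _).
  { symmetry. exact V1. }
  exists w. simpl. split.
  + refine (eq_trans (f_equal (comp m) (eq_sym W1)) _).
    unfold m. rewrite !comp_assoc. reflexivity.
  + rewrite reidx_meet. apply meet_glb.
    * apply (le_trans _ (meet_lel _ _)).
      rewrite <- reidx_comp.
      change (reidx P (lpb1 m (exc_map y)) (exc_pred x) ≤
        reidx P (lpb1 (exc_map x) (lpb1 f (exc_map y)) ∘ w) (exc_pred x)).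
      rewrite W1. apply le_refl.
    * apply (le_trans _ (meet_ler _ _)).
      rewrite <- !reidx_comp.
      change (reidx P (lpb2 m (exc_map y)) (exc_pred y) ≤
        reidx P (lpb2 f (exc_map y) ∘
          (lpb2 (exc_map x) (lpb1 f (exc_map y)) ∘ w)) (exc_pred y)).
      rewrite W2, V2. apply le_refl.
Qed.

Definition existential_completion_ex : full_existential existential_completion.
Proof.
apply (@FullExistential C existential_completion exc_ex).
- exact exc_adj.
- exact exc_beck_chevalley.
- exact exc_frobenius.
Defined.

End ExistentialCompletion.

Section TriposToTopos.
Variables (C : lex_category) (R : lex_primary_doctrine C)
  (HR : full_existential R).

Record tt_ob := TTOb {
  tt_car : C;
  tt_rel : R (lprd tt_car tt_car);
  tt_sym : tt_rel ≤ reidx R (lpair (lpi2 _ _) (lpi1 _ _)) tt_rel;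
  tt_trans :
    reidx R (lpair (tpi1 tt_car tt_car tt_car) (tpi2 _ _ _)) tt_rel ⊓
    reidx R (lpair (tpi2 _ _ _) (tpi3 _ _ _)) tt_rel
    ≤ reidx R (lpair (tpi1 _ _ _) (tpi3 _ _ _)) tt_rel
}.

Record is_tt_arrow (X Y : tt_ob) (phi : R (lprd (tt_car X) (tt_car Y))) : Prop :=
  IsTTArrow {
  tt_strict :
    phi ≤ reidx R (lpair (lpi1 _ _) (lpi1 _ _)) (tt_rel X) ⊓
          reidx R (lpair (lpi2 _ _) (lpi2 _ _)) (tt_rel Y);
  tt_ext_l :
    reidx R (lpair (tpi1 _ _ _) (tpi2 _ _ _)) (tt_rel X) ⊓
    reidx R (lpair (tpi1 (tt_car X) (tt_car X) (tt_car Y)) (tpi3 _ _ _)) phi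
    ≤ reidx R (lpair (tpi2 _ _ _) (tpi3 _ _ _)) phi;
  tt_ext_r :
    reidx R (lpair (tpi2 _ _ _) (tpi3 _ _ _)) (tt_rel Y) ⊓
    reidx R (lpair (tpi1 (tt_car X) (tt_car Y) (tt_car Y)) (tpi2 _ _ _)) phi
    ≤ reidx R (lpair (tpi1 _ _ _) (tpi3 _ _ _)) phi;
  tt_single :
    reidx R (lpair (tpi1 (tt_car X) (tt_car Y) (tt_car Y)) (tpi2 _ _ _)) phi ⊓
    reidx R (lpair (tpi1 _ _ _) (tpi3 _ _ _)) phi
    ≤ reidx R (lpair (tpi2 _ _ _) (tpi3 _ _ _)) (tt_rel Y);
  tt_total :
    reidx R (ldiag (tt_car X)) (tt_rel X) ≤ ex HR (lpi1 _ _) phi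
}.

Definition tt_hom (X Y : tt_ob) : Type :=
  {phi : R (lprd (tt_car X) (tt_car Y)) | is_tt_arrow phi}.

Lemma tt_hom_ext (X Y : tt_ob) (f g : tt_hom X Y) :
  proj1_sig f = proj1_sig g -> f = g.
Proof. apply eq_sig_hprop. intros. apply proof_irrelevance. Qed.

(* ∃b. phi(a, b) ∧ psi(b, d) *)
Definition rel_comp (A B D : C) (psi : R (lprd B D)) (phi : R (lprd A B)) :
    R (lprd A D) :=
  ex HR (lpair (tpi1 A B D) (tpi3 A B D))
    (reidx R (lpair (tpi1 A B D) (tpi2 A B D)) phi ⊓
     reidx R (lpair (tpi2 A B D) (tpi3 A B D)) psi).

(* phi(a, b), for generalized elements a and b at stage G. *)
Definition ap (G A B : C) (phi : R (lprd A B)) (a : Hom G A) (b : Hom G B) : R G :=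
  reidx R (lpair a b) phi.

Lemma ap_comp (G G' A B : C) (phi : R (lprd A B)) (a : Hom G A) (b : Hom G B)
    (k : Hom G' G) :
  reidx R k (ap phi a b) = ap phi (a ∘ k) (b ∘ k).
Proof. unfold ap. rewrite <- reidx_comp, lpair_comp. reflexivity. Qed.

Lemma ap_pi (A B : C) (phi : R (lprd A B)) : ap phi (lpi1 A B) (lpi2 A B) = phi.
Proof. unfold ap. rewrite lpair_eta. apply reidx_id. Qed.

Lemma le_ap (G G' A B : C) (phi : R (lprd A B)) (a : Hom G A) (b : Hom G B)
    (k : Hom G' G) (c : R G) (c' : R G') :
  c' ≤ reidx R k c -> c ≤ ap phi a b -> c' ≤ ap phi (a ∘ k) (b ∘ k).
Proof.
intros H K. rewrite <- ap_comp. apply (le_trans _ H). apply reidx_mono, K.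
Qed.

Lemma tpi1_pair (G A B D : C) (a : Hom G A) (b : Hom G B) (d : Hom G D) :
  tpi1 A B D ∘ lpair a (lpair b d) = a.
Proof. apply lpi1_pair. Qed.

Lemma tpi2_pair (G A B D : C) (a : Hom G A) (b : Hom G B) (d : Hom G D) :
  tpi2 A B D ∘ lpair a (lpair b d) = b.
Proof. unfold tpi2. rewrite <- comp_assoc, lpi2_pair. apply lpi1_pair. Qed.

Lemma tpi3_pair (G A B D : C) (a : Hom G A) (b : Hom G B) (d : Hom G D) :
  tpi3 A B D ∘ lpair a (lpair b d) = d.
Proof. unfold tpi3. rewrite <- comp_assoc, lpi2_pair. apply lpi2_pair. Qed.

Lemma le_meet2 (L : inf_semilattice) (x y z c : L) :
  x ⊓ y ≤ z -> c ≤ x -> c ≤ y -> c ≤ z.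
Proof. intros H K K'. apply (le_trans _ (meet_glb K K') H). Qed.

(* Kripke-Joyal elimination of an existential quantifier. *)
Lemma ex_elim (G A B : C) (m : Hom A B) (k : Hom G B) (x : R A) (c d : R G) :
  c ≤ reidx R k (ex HR m x) ->
  (forall (G' : C) (p : Hom G' G) (n : Hom G' A) (c' : R G'),
      k ∘ p = m ∘ n -> c' ≤ reidx R p c -> c' ≤ reidx R n x ->
      c' ≤ reidx R p d) ->
  c ≤ d.
Proof.
intros H K.
destruct (lpb_is_pullback m k) as [E U].
rewrite (ex_beck_chevalley HR (lpb_is_pullback m k)) in H.
rewrite (le_meetP H).
set (p := lpb2 m k). set (n := lpb1 m k).
apply (le_trans (ex HR p (reidx R n x) ⊓ c)).
{ apply meet_glb; [apply meet_ler | apply meet_lel]. }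
rewrite <- ex_frobenius. apply ex_adj.
apply (K _ p n); [symmetry; exact E | apply meet_ler | apply meet_lel].
Qed.

Lemma ex_intro_le (G A B : C) (m : Hom A B) (n : Hom G A) (x : R A) :
  reidx R n x ≤ reidx R (m ∘ n) (ex HR m x).
Proof. rewrite reidx_comp. apply reidx_mono. apply (ex_adj HR), le_refl. Qed.

Lemma rel_comp_intro (G A B D : C) (phi : R (lprd A B)) (psi : R (lprd B D))
    (a : Hom G A) (b : Hom G B) (d : Hom G D) (c : R G) :
  c ≤ ap phi a b -> c ≤ ap psi b d -> c ≤ ap (rel_comp psi phi) a d.
Proof.
intros H K.
pose proof (ex_intro_le (lpair (tpi1 A B D) (tpi3 A B D)) (lpair a (lpair b d))
  (reidx R (lpair (tpi1 A B D) (tpi2 A B D)) phi ⊓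
     reidx R (lpair (tpi2 A B D) (tpi3 A B D)) psi)) as I.
rewrite reidx_meet, <- !reidx_comp, !lpair_comp, tpi1_pair, tpi2_pair,
  tpi3_pair in I.
exact (le_trans _ (meet_glb H K) I).
Qed.

Lemma rel_comp_elim (G A B D : C) (phi : R (lprd A B)) (psi : R (lprd B D))
    (a : Hom G A) (d : Hom G D) (c e : R G) :
  c ≤ ap (rel_comp psi phi) a d ->
  (forall (G' : C) (p : Hom G' G) (b : Hom G' B) (c' : R G'),
     c' ≤ reidx R p c -> c' ≤ ap phi (a ∘ p) b -> c' ≤ ap psi b (d ∘ p) ->
     c' ≤ reidx R p e) ->
  c ≤ e.
Proof.
intros H K. apply (ex_elim H).
intros G' p n c' E L M.
rewrite !lpair_comp in E.
assert (E1 : a ∘ p = tpi1 A B D ∘ n).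
{ pose proof (f_equal (comp (lpi1 _ _)) E) as E1.
  rewrite !lpi1_pair in E1. exact E1. }
assert (E2 : d ∘ p = tpi3 A B D ∘ n).
{ pose proof (f_equal (comp (lpi2 _ _)) E) as E2.
  rewrite !lpi2_pair in E2. exact E2. }
rewrite reidx_meet in M. fold (ap phi (tpi1 A B D) (tpi2 A B D)) in M.
fold (ap psi (tpi2 A B D) (tpi3 A B D)) in M. rewrite !ap_comp in M.
apply (K _ p (tpi2 A B D ∘ n) c' L).
- rewrite E1. exact (le_trans _ M (meet_lel _ _)).
- rewrite E2. exact (le_trans _ M (meet_ler _ _)).
Qed.

Section Pointwise.
Variables (X Y : tt_ob).

Lemma tt_rel_sym (G : C) (a b : Hom G (tt_car X)) (c : R G) :
  c ≤ ap (tt_rel X) a b -> c ≤ ap (tt_rel X) b a.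
Proof.
intro H. apply (le_trans _ H).
pose proof (reidx_mono (lpair a b) (tt_sym X)) as S.
rewrite <- reidx_comp, lpair_comp, lpi1_pair, lpi2_pair in S. exact S.
Qed.

Lemma tt_rel_trans (G : C) (a b d : Hom G (tt_car X)) (c : R G) :
  c ≤ ap (tt_rel X) a b -> c ≤ ap (tt_rel X) b d -> c ≤ ap (tt_rel X) a d.
Proof.
apply le_meet2.
pose proof (reidx_mono (lpair a (lpair b d)) (tt_trans X)) as S.
rewrite reidx_meet, <- !reidx_comp, !lpair_comp, tpi1_pair, tpi2_pair, tpi3_pair
  in S. exact S.
Qed.

Variables (phi : R (lprd (tt_car X) (tt_car Y))) (Hphi : is_tt_arrow phi).

Lemma tt_arrow_strict_l (G : C) (a : Hom G (tt_car X)) (b : Hom G (tt_car Y))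
    (c : R G) :
  c ≤ ap phi a b -> c ≤ ap (tt_rel X) a a.
Proof.
intro H. apply (le_trans _ H).
pose proof (reidx_mono (lpair a b) (tt_strict Hphi)) as S.
rewrite reidx_meet, <- !reidx_comp, !lpair_comp, lpi1_pair, lpi2_pair in S.
exact (le_trans _ S (meet_lel _ _)).
Qed.

Lemma tt_arrow_strict_r (G : C) (a : Hom G (tt_car X)) (b : Hom G (tt_car Y))
    (c : R G) :
  c ≤ ap phi a b -> c ≤ ap (tt_rel Y) b b.
Proof.
intro H. apply (le_trans _ H).
pose proof (reidx_mono (lpair a b) (tt_strict Hphi)) as S.
rewrite reidx_meet, <- !reidx_comp, !lpair_comp, lpi1_pair, lpi2_pair in S.
exact (le_trans _ S (meet_ler _ _)).
Qed.

Lemma tt_arrow_ext_l (G : C) (a a' : Hom G (tt_car X)) (b : Hom G (tt_car Y))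
    (c : R G) :
  c ≤ ap (tt_rel X) a a' -> c ≤ ap phi a b -> c ≤ ap phi a' b.
Proof.
apply le_meet2.
pose proof (reidx_mono (lpair a (lpair a' b)) (tt_ext_l Hphi)) as S.
rewrite reidx_meet, <- !reidx_comp, !lpair_comp, tpi1_pair, tpi2_pair, tpi3_pair
  in S. exact S.
Qed.

Lemma tt_arrow_ext_r (G : C) (a : Hom G (tt_car X)) (b b' : Hom G (tt_car Y))
    (c : R G) :
  c ≤ ap (tt_rel Y) b b' -> c ≤ ap phi a b -> c ≤ ap phi a b'.
Proof.
apply le_meet2.
pose proof (reidx_mono (lpair a (lpair b b')) (tt_ext_r Hphi)) as S.
rewrite reidx_meet, <- !reidx_comp, !lpair_comp, tpi1_pair, tpi2_pair, tpi3_pair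
  in S. exact S.
Qed.

Lemma tt_arrow_single (G : C) (a : Hom G (tt_car X)) (b b' : Hom G (tt_car Y))
    (c : R G) :
  c ≤ ap phi a b -> c ≤ ap phi a b' -> c ≤ ap (tt_rel Y) b b'.
Proof.
apply le_meet2.
pose proof (reidx_mono (lpair a (lpair b b')) (tt_single Hphi)) as S.
rewrite reidx_meet, <- !reidx_comp, !lpair_comp, tpi1_pair, tpi2_pair, tpi3_pair
  in S. exact S.
Qed.

Lemma tt_arrow_total (G : C) (a : Hom G (tt_car X)) (c d : R G) :
  c ≤ ap (tt_rel X) a a ->
  (forall (G' : C) (p : Hom G' G) (b : Hom G' (tt_car Y)) (c' : R G'),
     c' ≤ reidx R p c -> c' ≤ ap phi (a ∘ p) b -> c' ≤ reidx R p d) ->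
  c ≤ d.
Proof.
intros H K.
pose proof (reidx_mono a (tt_total Hphi)) as S.
unfold ldiag in S. rewrite <- reidx_comp, lpair_comp, comp_idl in S.
apply (ex_elim (le_trans _ H S)).
intros G' p n c' E L M.
apply (K _ p (lpi2 _ _ ∘ n) c' L).
rewrite <- (ap_pi phi), ap_comp in M. rewrite E. exact M.
Qed.

End Pointwise.

Lemma is_tt_arrow_intro (X Y : tt_ob) (phi : R (lprd (tt_car X) (tt_car Y))) :
  (forall G a b (c : R G), c ≤ ap phi a b -> c ≤ ap (tt_rel X) a a) ->
  (forall G a b (c : R G), c ≤ ap phi a b -> c ≤ ap (tt_rel Y) b b) ->
  (forall G a a' b (c : R G),
     c ≤ ap (tt_rel X) a a' -> c ≤ ap phi a b -> c ≤ ap phi a' b) ->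
  (forall G a b b' (c : R G),
     c ≤ ap (tt_rel Y) b b' -> c ≤ ap phi a b -> c ≤ ap phi a b') ->
  (forall G a b b' (c : R G),
     c ≤ ap phi a b -> c ≤ ap phi a b' -> c ≤ ap (tt_rel Y) b b') ->
  (forall G a (c : R G), c ≤ ap (tt_rel X) a a ->
     c ≤ reidx R a (ex HR (lpi1 _ _) phi)) ->
  is_tt_arrow phi.
Proof.
intros H1 H2 H3 H4 H5 H6. constructor.
- apply meet_glb.
  + apply (H1 _ _ (lpi2 _ _)). rewrite ap_pi. apply le_refl.
  + apply (H2 _ (lpi1 _ _)). rewrite ap_pi. apply le_refl.
- apply (H3 _ (tpi1 _ _ _)); [apply meet_lel | apply meet_ler].
- apply (H4 _ _ (tpi2 _ _ _)); [apply meet_lel | apply meet_ler].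
- apply (H5 _ (tpi1 _ _ _)); [apply meet_lel | apply meet_ler].
- rewrite <- (reidx_id (ex HR (lpi1 _ _) phi)). apply H6, le_refl.
Qed.

Lemma ex_pi1_intro (G A B : C) (phi : R (lprd A B)) (a : Hom G A) (b : Hom G B)
    (c : R G) :
  c ≤ ap phi a b -> c ≤ reidx R a (ex HR (lpi1 A B) phi).
Proof.
intro H. apply (le_trans _ H).
pose proof (ex_intro_le (lpi1 A B) (lpair a b) phi) as I.
rewrite lpi1_pair in I. exact I.
Qed.

Definition tt_id (X : tt_ob) : tt_hom X X.
Proof.
exists (tt_rel X). apply is_tt_arrow_intro.
- intros G a b c H. exact (tt_rel_trans H (tt_rel_sym H)).
- intros G a b c H. exact (tt_rel_trans (tt_rel_sym H) H).
- intros G a a' b c H K. exact (tt_rel_trans (tt_rel_sym H) K).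
- intros G a b b' c H K. exact (tt_rel_trans K H).
- intros G a b b' c H K. exact (tt_rel_trans (tt_rel_sym H) K).
- intros G a c H. exact (ex_pi1_intro H).
Defined.

Lemma le_reidx (G G' : C) (k : Hom G' G) (c d : R G) (c' : R G') :
  c' ≤ reidx R k c -> c ≤ d -> c' ≤ reidx R k d.
Proof. intros H K. apply (le_trans _ H). apply reidx_mono, K. Qed.

Definition tt_comp (X Y Z : tt_ob) (g : tt_hom Y Z) (f : tt_hom X Y) :
  tt_hom X Z.
Proof.
exists (rel_comp (proj1_sig g) (proj1_sig f)).
destruct g as [psi Hpsi], f as [phi Hphi]. simpl. apply is_tt_arrow_intro.
- intros G a d c H. apply (rel_comp_elim H). intros G' p b c' L M N.
  rewrite ap_comp. exact (tt_arrow_strict_l Hphi M).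
- intros G a d c H. apply (rel_comp_elim H). intros G' p b c' L M N.
  rewrite ap_comp. exact (tt_arrow_strict_r Hpsi N).
- intros G a a' d c K H. apply (rel_comp_elim H). intros G' p b c' L M N.
  rewrite ap_comp. apply (rel_comp_intro (b := b)); [| exact N].
  exact (tt_arrow_ext_l Hphi (le_ap L K) M).
- intros G a d d' c K H. apply (rel_comp_elim H). intros G' p b c' L M N.
  rewrite ap_comp. apply (rel_comp_intro (b := b)); [exact M |].
  exact (tt_arrow_ext_r Hpsi (le_ap L K) N).
- intros G a d d' c H K. apply (rel_comp_elim H). intros G' p b c' L M N.
  apply (rel_comp_elim (le_ap L K)). intros G'' q b' c'' L' M' N'.
  rewrite !ap_comp.
  apply (tt_arrow_single Hpsi (a := b')); [| exact N'].
  apply (tt_arrow_ext_l Hpsi (a := b ∘ q)); [| exact (le_ap L' N)].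
  exact (tt_arrow_single Hphi (le_ap L' M) M').
- intros G a c H. apply (tt_arrow_total Hphi H). intros G' p b c' L M.
  apply (tt_arrow_total Hpsi (tt_arrow_strict_r Hphi M)).
  intros G'' q d c'' L' N.
  rewrite <- !reidx_comp. apply (ex_pi1_intro (b := d)).
  apply (rel_comp_intro (b := b ∘ q)); [| exact N].
  rewrite comp_assoc. exact (le_ap L' M).
Defined.

Lemma rel_ext_le (A B : C) (phi psi : R (lprd A B)) :
  (forall G a b (c : R G), c ≤ ap phi a b -> c ≤ ap psi a b) -> phi ≤ psi.
Proof.
intro H. rewrite <- (ap_pi psi). apply H. rewrite ap_pi. apply le_refl.
Qed.

Lemma tt_comp_idl (X Y : tt_ob) (f : tt_hom X Y) : tt_comp (tt_id Y) f = f.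
Proof.
apply tt_hom_ext. destruct f as [phi Hphi]. simpl.
apply le_antisym; apply rel_ext_le.
- intros G a d c H. apply (rel_comp_elim H). intros G' p b c' L M N.
  rewrite ap_comp. exact (tt_arrow_ext_r Hphi N M).
- intros G a b c H. exact (rel_comp_intro H (tt_arrow_strict_r Hphi H)).
Qed.

Lemma tt_comp_idr (X Y : tt_ob) (f : tt_hom X Y) : tt_comp f (tt_id X) = f.
Proof.
apply tt_hom_ext. destruct f as [phi Hphi]. simpl.
apply le_antisym; apply rel_ext_le.
- intros G a d c H. apply (rel_comp_elim H). intros G' p b c' L M N.
  rewrite ap_comp. exact (tt_arrow_ext_l Hphi (tt_rel_sym M) N).
- intros G a b c H. exact (rel_comp_intro (tt_arrow_strict_l Hphi H) H).
Qed.

Lemma tt_comp_assoc (X Y Z W : tt_ob) (h : tt_hom Z W) (g : tt_hom Y Z)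
    (f : tt_hom X Y) :
  tt_comp h (tt_comp g f) = tt_comp (tt_comp h g) f.
Proof.
apply tt_hom_ext. destruct f as [phi Hphi], g as [psi Hpsi], h as [chi Hchi].
simpl. apply le_antisym; apply rel_ext_le.
- intros G a e c H. apply (rel_comp_elim H). intros G' p d c' L M N.
  apply (rel_comp_elim M). intros G'' q b c'' L' M' N'.
  rewrite !ap_comp. apply (rel_comp_intro M').
  exact (rel_comp_intro N' (le_ap L' N)).
- intros G a e c H. apply (rel_comp_elim H). intros G' p b c' L M N.
  apply (rel_comp_elim N). intros G'' q d c'' L' M' N'.
  rewrite !ap_comp. apply (fun h => rel_comp_intro h N').
  exact (rel_comp_intro (le_ap L' M) M').
Qed.

Definition tripos_to_topos : category :=
  @Category tt_ob tt_hom tt_id tt_comp tt_comp_idl tt_comp_idr tt_comp_assoc.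

End TriposToTopos.

Lemma mono_from_one (E : lex_category) (B : E) (m : Hom (lone E) B) : mono m.
Proof.
intros X u v _. transitivity (lto_one X).
- apply to_one_uniq.
- symmetry. apply to_one_uniq.
Qed.

(* The definition of Mac Lane and Moerdijk: finite limits, a subobject classifier
   and, for each B, an object PB with a membership arrow B × PB → Ω through which
   every arrow B × A → Ω factors by a unique arrow A → PB. *)
Record elementary_topos (T : category) := ElementaryTopos {
  topos_lim : finite_limits T;
  topos_lex : lex_category := LexCategory topos_lim;
  Omega : topos_lex;
  tru : Hom (lone topos_lex) Omega;
  chi : forall (U X : topos_lex) (m : Hom U X), mono m -> Hom X Omega;
  chi_pullback : forall (U X : topos_lex) (m : Hom U X) (Hm : mono m),
    is_pullback (chi Hm) tru m (lto_one U);
  chi_uniq : forall (U X : topos_lex) (m : Hom U X) (Hm : mono m)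
      (c : Hom X Omega),
    is_pullback c tru m (lto_one U) -> c = chi Hm;
  pow : topos_lex -> topos_lex;
  mem : forall B : topos_lex, Hom (lprd B (pow B)) Omega;
  pow_transpose : forall (A B : topos_lex) (f : Hom (lprd B A) Omega),
    exists! g : Hom A (pow B), f = mem B ∘ lprd_map (idm B) g
}.

Section LawvereTierney.
Variables (T : category) (E : elementary_topos T).
Let L : lex_category := topos_lex E.

Definition Omega_meet : Hom (lprd (C := L) (Omega E) (Omega E)) (Omega E) :=
  chi (mono_from_one (m := lpair (tru E) (tru E))).

Record lawvere_tierney := LawvereTierney {
  lt_j : Hom (Omega E) (Omega E);
  lt_tru : lt_j ∘ tru E = tru E;
  lt_idem : lt_j ∘ lt_j = lt_j;
  lt_meet : lt_j ∘ Omega_meet = Omega_meet ∘ lprd_map (C := L) lt_j lt_j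
}.

Variable j : lawvere_tierney.

Definition dense (U X : L) (m : Hom U X) : Prop :=
  exists Hm : mono m, lt_j j ∘ chi Hm = tru E ∘ lto_one X.

Definition is_sheaf (F : L) : Prop :=
  forall (U X : L) (m : Hom U X), dense m ->
    forall f : Hom U F, exists! g : Hom X F, g ∘ m = f.

End LawvereTierney.

Definition full_subcategory (T : category) (S : T -> Prop) : category :=
  @Category {A : T | S A} (fun A B => Hom (proj1_sig A) (proj1_sig B))
    (fun A => idm (proj1_sig A)) (fun _ _ _ g f => g ∘ f)
    (fun _ _ f => comp_idl f) (fun _ _ f => comp_idr f)
    (fun _ _ _ _ h g f => comp_assoc h g f).

Definition sheaves (T : category) (E : elementary_topos T)
    (j : lawvere_tierney E) : category :=
  full_subcategory (T := T) (is_sheaf j).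

Record functor (S T : category) := Functor {
  fob :> S -> T;
  fmap : forall A B : S, Hom A B -> Hom (fob A) (fob B);
  fmap_id : forall A : S, fmap (idm A) = idm (fob A);
  fmap_comp : forall (A B D : S) (g : Hom B D) (f : Hom A B),
    fmap (g ∘ f) = fmap g ∘ fmap f
}.

Definition functor_id (S : category) : functor S S :=
  @Functor S S (fun A => A) (fun _ _ f => f) (fun _ => eq_refl)
    (fun _ _ _ _ _ => eq_refl).

Definition functor_comp (S T U : category) (G : functor T U) (F : functor S T) :
  functor S U.
Proof.
apply (@Functor S U (fun A => G (F A)) (fun _ _ f => fmap G (fmap F f))).
- intro A. rewrite fmap_id. apply fmap_id.
- intros A B D g f. rewrite fmap_comp. apply fmap_comp.
Defined.

Definition naturally_isomorphic (S T : category) (F G : functor S T) : Prop :=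
  exists t : forall A : S, Hom (F A) (G A),
    (forall A : S, is_iso (t A)) /\
    (forall (A B : S) (f : Hom A B), t B ∘ fmap F f = fmap G f ∘ t A).

Definition equivalent_categories (S T : category) : Prop :=
  exists (F : functor S T) (G : functor T S),
    naturally_isomorphic (functor_comp G F) (functor_id S) /\
    naturally_isomorphic (functor_comp F G) (functor_id T).

(* Main.v *)
(* Sending (f, α) to ∃_f α is a fibrewise left adjoint, natural and preserving
   finite meets, of the inclusion of P in R := P^∃, and it is the identity on P.
   So each fibre of R carries a natural closure operator cl preserving finite
   meets, with the elements of P as closed elements, and cl applied to the
   generic proposition is a topology j on T_R.  The induced functor T_R → T_P is
   full and faithful on j-sheaves, because it inverts dense monomorphisms and
   because the equality of a sheaf is closed on existing elements.  It is
   essentially surjective, because every object of T_P is isomorphic to its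
   object of singletons, on which functional relations are tracked by arrows of
   C; the same object, with the same equality seen in R, is then a sheaf.

   R is a tripos because R(A) is the poset reflection of the slice of the
   category of points over (A, ⊤): there weak dependent products compute
   ∀_g(φ → ψ), and a generic proof with weak exponentials gives weak power
   objects. *)
Require Import Defs.
From Stdlib Require Import IndefiniteDescription.

Set Implicit Arguments.
Unset Strict Implicit.
Unset Printing Implicit Defensive.

(* Everything is argued at generalized elements, in the style of Kripke and Joyal: [c ≤ ap phi a b]
   says that φ(a, b) holds at stage G under the assumption c, and opening an existential moves the
   argument to a new stage. The obstacle is totality. A functional relation of T_P, read in R
   through the inclusion of P, is total only up to closure, because this inclusion need not commute
   with ∃. Two devices deal with it. For fullness, the relation is restricted to the dense subobject
   on which R provides witnesses, and the sheaf condition extends it again. For essential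
   surjectivity, the target is replaced by an object into which every functional relation is tracked
   by an arrow of C: the graph of an arrow that preserves equality is total in any doctrine, hence
   also in R. The passage from R to P meets no such obstacle. The left adjoint preserves
   substitution, ∧ and ∃, and these are all that the definitions of objects and arrows of the topos
   mention. *)
Create HintDb kj.
#[local] Hint Rewrite reidx_meet reidx_id lpair_comp lpi1_pair lpi2_pair
  comp_idl comp_idr : kj.
#[local] Hint Rewrite <- reidx_comp comp_assoc : kj.

(** Turns iterated reindexings into one substitution under [ap], with composites associated to the
    right, and splits conjunctions on the right of ≤. *)
Ltac kj :=
  unfold ap in *; cbn beta in *;
  repeat (progress autorewrite with kj in * ||
    match goal with
    | H : _ ≤ _ ⊓ _ |- _ => apply le_meet_iff in H; destruct H
    | |- _ ≤ _ ⊓ _ => apply meet_glb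
    end);
  repeat match goal with
    | H : context [reidx ?R (lpair ?a ?b) ?phi] |- _ =>
        change (reidx R (lpair a b) phi) with (ap phi a b) in H
    | |- context [reidx ?R (lpair ?a ?b) ?phi] =>
        change (reidx R (lpair a b) phi) with (ap phi a b)
    end.

(* Moves the hypotheses from the stage c to the stage c' along
   L : c' ≤ reidx R p c. *)
Ltac shift L :=
  match type of L with
  | _ ≤ reidx _ _ ?c =>
    repeat match goal with
    | H : c ≤ _ |- _ => apply (le_reidx L) in H
    end
  end; kj.

Notation rel f := (proj1_sig f).

(** * Generalized elements *)

Section Quantifiers.
Variables (C : lex_category) (R : lex_primary_doctrine C)
  (HR : full_existential R).

Definition exq (A B : C) (phi : R (lprd A B)) : R A := ex HR (lpi1 A B) phi.

Lemma exq_intro (G A B : C) (phi : R (lprd A B)) (a : Hom G A) (b : Hom G B)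
    (c : R G) :
  c ≤ ap phi a b -> c ≤ reidx R a (exq phi).
Proof. apply ex_pi1_intro. Qed.

Lemma exq_elim (G A B : C) (phi : R (lprd A B)) (a : Hom G A) (c d : R G) :
  c ≤ reidx R a (exq phi) ->
  (forall (G' : C) (p : Hom G' G) (b : Hom G' B) (c' : R G'),
     c' ≤ reidx R p c -> c' ≤ ap phi (a ∘ p) b -> c' ≤ reidx R p d) ->
  c ≤ d.
Proof.
intros H K. apply (ex_elim H). intros G' p n c' E L M.
apply (K _ p (lpi2 _ _ ∘ n) c' L). rewrite E, <- ap_comp, ap_pi. exact M.
Qed.

End Quantifiers.

(* fa g φ ψ is ∀_g(φ → ψ); the remaining fields are weak power objects. *)
Record higher_order (C : lex_category) (R : lex_primary_doctrine C) :=
  HigherOrder {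
  fa : forall A B : C, Hom B A -> R B -> R B -> R A;
  fa_adj : forall (A B : C) (g : Hom B A) (x y : R B) (z : R A),
    z ≤ fa g x y <-> reidx R g z ⊓ x ≤ y;
  wpow : C -> C;
  wmem : forall X : C, R (lprd X (wpow X));
  wname : forall (X Y : C) (b : R (lprd X Y)), exists d : Hom Y (wpow X),
    b = reidx R (lprd_map (idm X) d) (wmem X)
}.

Section HigherOrder.
Variables (C : lex_category) (R : lex_primary_doctrine C)
  (HR : full_existential R) (HO : higher_order R).

(** Stability of ∀_g(φ → ψ) under substitution is derived: by adjunction the goal becomes g^*∃_k c ∧
    φ ≤ ψ, and Beck-Chevalley and Frobenius for ∃ move it to the pullback of k and g. *)
Lemma fa_intro (G A B : C) (g : Hom B A) (phi psi : R B) (k : Hom G A)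
    (c : R G) :
  (forall (G' : C) (p : Hom G' G) (n : Hom G' B) (c' : R G'),
     k ∘ p = g ∘ n -> c' ≤ reidx R p c -> c' ≤ reidx R n phi ->
     c' ≤ reidx R n psi) ->
  c ≤ reidx R k (fa HO g phi psi).
Proof.
intro H. apply (ex_adj HR), fa_adj.
destruct (lpb_is_pullback k g) as [E U].
rewrite (ex_beck_chevalley HR (lpb_is_pullback k g)), <- ex_frobenius.
apply ex_adj. apply (H _ (lpb1 k g)); [exact E | apply meet_lel | apply meet_ler].
Qed.

Lemma fa_elim (G A B : C) (g : Hom B A) (phi psi : R B) (n : Hom G B)
    (c : R G) :
  c ≤ reidx R (g ∘ n) (fa HO g phi psi) -> c ≤ reidx R n phi ->
  c ≤ reidx R n psi.
Proof.
rewrite reidx_comp. apply le_meet2. rewrite <- reidx_meet. apply reidx_mono.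
apply (fa_adj HO), le_refl.
Qed.

(* ∀b. phi(a, b) ↔ psi(a, b) *)
Definition iffq (A B : C) (phi psi : R (lprd A B)) : R A :=
  fa HO (lpi1 A B) phi psi ⊓ fa HO (lpi1 A B) psi phi.

Lemma iffq_intro (G A B : C) (phi psi : R (lprd A B)) (a : Hom G A) (c : R G) :
  (forall (G' : C) (p : Hom G' G) (b : Hom G' B) (c' : R G'),
     c' ≤ reidx R p c ->
     (c' ≤ ap phi (a ∘ p) b <-> c' ≤ ap psi (a ∘ p) b)) ->
  c ≤ reidx R a (iffq phi psi).
Proof.
intro H. unfold iffq. rewrite reidx_meet.
assert (K : forall (G' : C) (p : Hom G' G) (n : Hom G' (lprd A B)) (c' : R G'),
  a ∘ p = lpi1 A B ∘ n -> c' ≤ reidx R p c ->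
  (c' ≤ reidx R n phi <-> c' ≤ reidx R n psi)).
{ intros G' p n c' E L. pose proof (H _ p (lpi2 A B ∘ n) c' L) as K.
  rewrite E, <- !ap_comp, !ap_pi in K. exact K. }
apply meet_glb; apply fa_intro; intros G' p n c' E L; apply (K _ p n c' E L).
Qed.

Lemma iffq_elim (G A B : C) (phi psi : R (lprd A B)) (a : Hom G A)
    (b : Hom G B) (c : R G) :
  c ≤ reidx R a (iffq phi psi) -> (c ≤ ap phi a b <-> c ≤ ap psi a b).
Proof.
unfold iffq. rewrite reidx_meet, le_meet_iff. intros [H K].
split; intro M; [refine (fa_elim _ M) | refine (fa_elim _ M)];
  rewrite lpi1_pair; eassumption.
Qed.

End HigherOrder.

(** * Functional relations, terminal object and products *)

Section Regular.
Variables (C : lex_category) (R : lex_primary_doctrine C)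
  (HR : full_existential R).

Section Homs.
Variables (X Y : tt_ob R) (f : tt_hom HR X Y) (G : C).
Implicit Types (a : Hom G (tt_car X)) (b : Hom G (tt_car Y)) (c : R G).

Definition hom_strict_l a b c :=
  @tt_arrow_strict_l _ _ _ _ _ _ (proj2_sig f) G a b c.
Definition hom_strict_r a b c :=
  @tt_arrow_strict_r _ _ _ _ _ _ (proj2_sig f) G a b c.
Definition hom_ext_l a a' b c :=
  @tt_arrow_ext_l _ _ _ _ _ _ (proj2_sig f) G a a' b c.
Definition hom_ext_r a b b' c :=
  @tt_arrow_ext_r _ _ _ _ _ _ (proj2_sig f) G a b b' c.
Definition hom_single a b b' c :=
  @tt_arrow_single _ _ _ _ _ _ (proj2_sig f) G a b b' c.
Definition hom_total a c d :=
  @tt_arrow_total _ _ _ _ _ _ (proj2_sig f) G a c d.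
End Homs.

(** One inclusion is enough: if g(a, b), totality gives b' with f(a, b'), hence g(a, b'), and
    single-valuedness of g identifies b' with b. *)
Lemma hom_eq (X Y : tt_ob R) (f g : tt_hom HR X Y) :
  (forall G a b (c : R G), c ≤ ap (rel f) a b -> c ≤ ap (rel g) a b) -> f = g.
Proof.
intro H. apply tt_hom_ext. apply le_antisym; apply rel_ext_le; [exact H |].
intros G a b c K. apply (hom_total (f := f) (hom_strict_l K)).
intros G' p b' c' L M. rewrite ap_comp.
apply (hom_ext_r (b := b')); [| exact M].
apply (hom_single (H _ _ _ _ M)). exact (le_ap L K).
Qed.

Definition tt_ob_intro (A : C) (rho : R (lprd A A))
    (Hs : forall G (a b : Hom G A) c, c ≤ ap rho a b -> c ≤ ap rho b a)
    (Ht : forall G (a b d : Hom G A) c,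
      c ≤ ap rho a b -> c ≤ ap rho b d -> c ≤ ap rho a d) : tt_ob R.
Proof.
apply (@TTOb C R A rho).
- apply Hs. rewrite ap_pi. apply le_refl.
- apply (Ht _ _ (tpi2 _ _ _)); [apply meet_lel | apply meet_ler].
Defined.

(** The first conjunct makes the relation strict: f(a) may exist where a does not. *)
Definition tt_graph (X Y : tt_ob R) (f : Hom (tt_car X) (tt_car Y))
    (Hf : forall G (a b : Hom G (tt_car X)) c,
      c ≤ ap (tt_rel X) a b -> c ≤ ap (tt_rel Y) (f ∘ a) (f ∘ b)) :
  tt_hom HR X Y.
Proof.
exists (ap (tt_rel X) (lpi1 _ _) (lpi1 _ _) ⊓
   ap (tt_rel Y) (f ∘ lpi1 _ _) (lpi2 _ _)).
apply is_tt_arrow_intro; intros; kj; try assumption.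
- exact (tt_rel_trans (tt_rel_sym H0) H0).
- exact (tt_rel_trans (tt_rel_sym H) H).
- exact (tt_rel_trans (tt_rel_sym (Hf _ _ _ _ H)) H1).
- exact (tt_rel_trans H1 H).
- exact (tt_rel_trans (tt_rel_sym H2) H1).
- apply (ex_pi1_intro HR (b := f ∘ a)). kj; [assumption | apply Hf, H].
Defined.

Lemma tt_graph_spec (X Y : tt_ob R) f (Hf : forall G (a b : Hom G (tt_car X)) c,
      c ≤ ap (tt_rel X) a b -> c ≤ ap (tt_rel Y) (f ∘ a) (f ∘ b))
    (G : C) (a : Hom G (tt_car X)) (b : Hom G (tt_car Y)) (c : R G) :
  c ≤ ap (rel (tt_graph Hf)) a b <->
  c ≤ ap (tt_rel X) a a /\ c ≤ ap (tt_rel Y) (f ∘ a) b.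
Proof.
unfold tt_graph, ap. simpl. unfold ap. autorewrite with kj. apply le_meet_iff.
Qed.

Definition tt_one : tt_ob R.
Proof.
apply (@tt_ob_intro (lone C) top); intros; unfold ap; rewrite reidx_top;
  apply le_top.
Defined.

Lemma tt_one_rel (G : C) (a b : Hom G (lone C)) (c : R G) :
  c ≤ ap (tt_rel tt_one) a b.
Proof. unfold ap. simpl. rewrite reidx_top. apply le_top. Qed.

Definition tt_to_one (X : tt_ob R) : tt_hom HR X tt_one :=
  @tt_graph X tt_one (lto_one _) (fun _ _ _ _ _ => tt_one_rel _ _ _).

Lemma tt_to_one_uniq (X : tt_ob R) (f : tt_hom HR X tt_one) : f = tt_to_one X.
Proof.
apply hom_eq. intros G a b c H. apply tt_graph_spec. split.
- exact (hom_strict_l H).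
- apply tt_one_rel.
Qed.

Definition tt_prd (X Y : tt_ob R) : tt_ob R.
Proof.
apply (@tt_ob_intro (lprd (tt_car X) (tt_car Y))
  (ap (tt_rel X) (lpi1 _ _ ∘ lpi1 _ _) (lpi1 _ _ ∘ lpi2 _ _) ⊓
   ap (tt_rel Y) (lpi2 _ _ ∘ lpi1 _ _) (lpi2 _ _ ∘ lpi2 _ _)));
intros; kj.
- exact (tt_rel_sym H).
- exact (tt_rel_sym H0).
- exact (tt_rel_trans H H0).
- exact (tt_rel_trans H2 H1).
Defined.

Lemma tt_prd_spec (X Y : tt_ob R) (G : C)
    (a b : Hom G (lprd (tt_car X) (tt_car Y))) (c : R G) :
  c ≤ ap (tt_rel (tt_prd X Y)) a b <->
  c ≤ ap (tt_rel X) (lpi1 _ _ ∘ a) (lpi1 _ _ ∘ b) /\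
  c ≤ ap (tt_rel Y) (lpi2 _ _ ∘ a) (lpi2 _ _ ∘ b).
Proof.
unfold ap. simpl. unfold ap. autorewrite with kj. apply le_meet_iff.
Qed.

Definition tt_pi1 (X Y : tt_ob R) : tt_hom HR (tt_prd X Y) X.
Proof.
apply (@tt_graph (tt_prd X Y) X (lpi1 _ _)).
intros G a b c H. apply tt_prd_spec in H. apply H.
Defined.

Definition tt_pi2 (X Y : tt_ob R) : tt_hom HR (tt_prd X Y) Y.
Proof.
apply (@tt_graph (tt_prd X Y) Y (lpi2 _ _)).
intros G a b c H. apply tt_prd_spec in H. apply H.
Defined.

Definition pair_rel (X Y Z : C) (f : R (lprd X Y)) (g : R (lprd X Z)) :
    R (lprd X (lprd Y Z)) :=
  ap f (lpi1 _ _) (lpi1 _ _ ∘ lpi2 _ _) ⊓ ap g (lpi1 _ _) (lpi2 _ _ ∘ lpi2 _ _).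

Lemma pair_rel_spec (X Y Z : C) (f : R (lprd X Y)) (g : R (lprd X Z)) (G : C)
    (a : Hom G X) (b : Hom G (lprd Y Z)) (c : R G) :
  c ≤ ap (pair_rel f g) a b <->
  c ≤ ap f a (lpi1 _ _ ∘ b) /\ c ≤ ap g a (lpi2 _ _ ∘ b).
Proof.
unfold pair_rel, ap. autorewrite with kj. apply le_meet_iff.
Qed.

Definition tt_pair (X Y Z : tt_ob R) (f : tt_hom HR X Y) (g : tt_hom HR X Z) :
  tt_hom HR X (tt_prd Y Z).
Proof.
exists (pair_rel (rel f) (rel g)).
apply is_tt_arrow_intro; intros; unfold pair_rel in *;
  cbn [tt_car tt_rel tt_prd tt_ob_intro] in *; kj.
- exact (hom_strict_l H).
- exact (hom_strict_r H).
- exact (hom_strict_r H0).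
- exact (hom_ext_l H H0).
- exact (hom_ext_l H H1).
- exact (hom_ext_r H H0).
- exact (hom_ext_r H2 H1).
- exact (hom_single H H0).
- exact (hom_single H2 H1).
- apply (hom_total (f := f) H). intros G' p b c' L M.
  shift L. apply (hom_total (f := g) H). intros G'' q d c'' L' N.
  shift L'. apply (ex_pi1_intro HR (b := lpair (b ∘ q) d)).
  kj; assumption.
Defined.

End Regular.

(** [tot f H] takes a value [y] of [f] at the element that exists by [H]; [elimq] opens an
    existential. Both pass to a new stage and carry the hypotheses along with [shift]. *)
Ltac tot f H :=
  let G := fresh "G" in let p := fresh "p" in let y := fresh "y" in
  let c := fresh "c" in let L := fresh "L" in let M := fresh "M" in
  apply (hom_total (f := f) H); intros G p y c L M; shift L.
Tactic Notation "elimq" uconstr(t) :=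
  let G := fresh "G" in let p := fresh "p" in let y := fresh "y" in
  let c := fresh "c" in let L := fresh "L" in
  refine (t _); intros G p y c L; intros; shift L.

(** * Finite limits *)

Section FiniteLimits.
Variables (C : lex_category) (R : lex_primary_doctrine C)
  (HR : full_existential R).

Lemma comp_intro (X Y Z : tt_ob R) (f : tt_hom HR X Y) (g : tt_hom HR Y Z)
    (G : C) (a : Hom G (tt_car X)) (b : Hom G (tt_car Y)) (d : Hom G (tt_car Z))
    (c : R G) :
  c ≤ ap (rel f) a b -> c ≤ ap (rel g) b d -> c ≤ ap (rel (tt_comp g f)) a d.
Proof. apply rel_comp_intro. Qed.

Lemma comp_elim (X Y Z : tt_ob R) (f : tt_hom HR X Y) (g : tt_hom HR Y Z)
    (G : C) (a : Hom G (tt_car X)) (d : Hom G (tt_car Z)) (c e : R G) :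
  c ≤ ap (rel (tt_comp g f)) a d ->
  (forall (G' : C) (p : Hom G' G) (b : Hom G' (tt_car Y)) (c' : R G'),
     c' ≤ reidx R p c -> c' ≤ ap (rel f) (a ∘ p) b ->
     c' ≤ ap (rel g) b (d ∘ p) -> c' ≤ reidx R p e) ->
  c ≤ e.
Proof. apply rel_comp_elim. Qed.

(** Single-valuedness of f removes the existential of the composite once some value of f is
    known. *)
Lemma comp_spec (X Y Z : tt_ob R) (f : tt_hom HR X Y) (g : tt_hom HR Y Z)
    (G : C) (a : Hom G (tt_car X)) (b : Hom G (tt_car Y)) (d : Hom G (tt_car Z))
    (c : R G) :
  c ≤ ap (rel f) a b ->
  (c ≤ ap (rel (tt_comp g f)) a d <-> c ≤ ap (rel g) b d).
Proof.
intro H. split; [| apply comp_intro, H].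
intro K. elimq (comp_elim K).
exact (hom_ext_l (hom_single H0 H) H1).
Qed.

Lemma graph_comp_spec (X Y Z : tt_ob R) k
    (Hk : forall G (a b : Hom G (tt_car X)) c,
      c ≤ ap (tt_rel X) a b -> c ≤ ap (tt_rel Y) (k ∘ a) (k ∘ b))
    (g : tt_hom HR Y Z) (G : C) (a : Hom G (tt_car X)) (d : Hom G (tt_car Z))
    (c : R G) :
  c ≤ ap (rel (tt_comp g (tt_graph HR Hk))) a d <->
  c ≤ ap (tt_rel X) a a /\ c ≤ ap (rel g) (k ∘ a) d.
Proof.
split.
- intro H. pose proof (hom_strict_l H) as K. split; [exact K |].
  refine (proj1 (comp_spec _ _ _) H). apply tt_graph_spec.
  split; [exact K | apply Hk, K].
- intros [H K]. apply (comp_intro (b := k ∘ a)); [| exact K].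
  apply tt_graph_spec. split; [exact H | apply Hk, H].
Qed.

Lemma comp_graph_spec (X Y Z : tt_ob R) k
    (Hk : forall G (a b : Hom G (tt_car Y)) c,
      c ≤ ap (tt_rel Y) a b -> c ≤ ap (tt_rel Z) (k ∘ a) (k ∘ b))
    (f : tt_hom HR X Y) (G : C) (a : Hom G (tt_car X)) (b : Hom G (tt_car Y))
    (d : Hom G (tt_car Z)) (c : R G) :
  c ≤ ap (rel f) a b ->
  (c ≤ ap (rel (tt_comp (tt_graph HR Hk) f)) a d <->
   c ≤ ap (tt_rel Z) (k ∘ b) d).
Proof.
intro H. rewrite (comp_spec _ _ H), tt_graph_spec. split; [intros [_ K]; exact K |].
intro K. split; [exact (hom_strict_r H) | exact K].
Qed.

Definition ext_pred (X : tt_ob R) (D : R (tt_car X)) : Prop :=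
  forall (G : C) (a b : Hom G (tt_car X)) (c : R G),
    c ≤ ap (tt_rel X) a b -> c ≤ reidx R a D -> c ≤ reidx R b D.

(** A subobject keeps the carrier and restricts the equality, so that an element exists only where D
    holds. *)
Definition tt_sub (X : tt_ob R) (D : R (tt_car X)) (HD : ext_pred D) : tt_ob R.
Proof.
apply (@tt_ob_intro C R (tt_car X) (tt_rel X ⊓ reidx R (lpi1 _ _) D));
  intros; kj.
- exact (tt_rel_sym H).
- exact (HD _ _ _ _ H H0).
- exact (tt_rel_trans H H0).
- assumption.
Defined.

Lemma tt_sub_spec (X : tt_ob R) D (HD : ext_pred (X := X) D)
    (G : C) (a b : Hom G (tt_car X)) (c : R G) :
  c ≤ ap (tt_rel (tt_sub HD)) a b <->
  c ≤ ap (tt_rel X) a b /\ c ≤ reidx R a D.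
Proof. unfold ap. simpl. autorewrite with kj. apply le_meet_iff. Qed.

Definition tt_incl (X : tt_ob R) (D : R (tt_car X)) (HD : ext_pred (X := X) D) :
  tt_hom HR (tt_sub HD) X.
Proof.
apply (@tt_graph C R HR (tt_sub HD) X (idm _)).
intros G a b c H. rewrite !comp_idl. apply tt_sub_spec in H. apply H.
Defined.

Lemma tt_incl_spec (X : tt_ob R) D (HD : ext_pred (X := X) D)
    (G : C) (a b : Hom G (tt_car X)) (c : R G) :
  c ≤ ap (rel (tt_incl HD)) a b <->
  c ≤ ap (tt_rel X) a b /\ c ≤ reidx R a D.
Proof.
unfold tt_incl. rewrite tt_graph_spec, tt_sub_spec, comp_idl. split; [tauto |].
intros [H K]. repeat split; try assumption.
exact (tt_rel_trans H (tt_rel_sym H)).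
Qed.

Definition tt_lift (X Y : tt_ob R) (D : R (tt_car Y)) (HD : ext_pred (X := Y) D)
    (f : tt_hom HR X Y)
    (Hf : forall (G : C) (a : Hom G (tt_car X)) (b : Hom G (tt_car Y)) (c : R G),
      c ≤ ap (rel f) a b -> c ≤ reidx R b D) :
  tt_hom HR X (tt_sub HD).
Proof.
exists (rel f). apply is_tt_arrow_intro; intros.
- exact (hom_strict_l (f := f) H).
- apply tt_sub_spec. split; [exact (hom_strict_r (f := f) H) | exact (Hf _ _ _ _ H)].
- exact (hom_ext_l (f := f) H H0).
- apply tt_sub_spec in H. exact (hom_ext_r (f := f) (proj1 H) H0).
- apply tt_sub_spec. split; [exact (hom_single (f := f) H H0) | exact (Hf _ _ _ _ H)].
- tot f H. apply (ex_pi1_intro HR M).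
Defined.

Section Pullback.
Variables (X Y Z : tt_ob R) (f : tt_hom HR X Z) (g : tt_hom HR Y Z).

Definition pb_pred : R (lprd (tt_car X) (tt_car Y)) :=
  exq HR (ap (rel f) (lpi1 _ _ ∘ lpi1 _ _) (lpi2 _ (tt_car Z)) ⊓
          ap (rel g) (lpi2 _ _ ∘ lpi1 _ _) (lpi2 _ (tt_car Z))).

Lemma pb_pred_intro (G : C) (a : Hom G (lprd (tt_car X) (tt_car Y)))
    (d : Hom G (tt_car Z)) (c : R G) :
  c ≤ ap (rel f) (lpi1 _ _ ∘ a) d -> c ≤ ap (rel g) (lpi2 _ _ ∘ a) d ->
  c ≤ reidx R a pb_pred.
Proof. intros. apply (exq_intro HR (b := d)). kj; assumption. Qed.

Lemma pb_pred_elim (G : C) (a : Hom G (lprd (tt_car X) (tt_car Y))) (c e : R G) :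
  c ≤ reidx R a pb_pred ->
  (forall (G' : C) (p : Hom G' G) (d : Hom G' (tt_car Z)) (c' : R G'),
     c' ≤ reidx R p c -> c' ≤ ap (rel f) (lpi1 _ _ ∘ a ∘ p) d ->
     c' ≤ ap (rel g) (lpi2 _ _ ∘ a ∘ p) d -> c' ≤ reidx R p e) ->
  c ≤ e.
Proof.
intros H K. apply (exq_elim H). intros G' p d c' L M. kj.
apply (K _ _ d _ L); kj; assumption.
Qed.

Lemma pb_pred_ext : ext_pred (X := tt_prd X Y) pb_pred.
Proof.
intros G a b c H K. apply tt_prd_spec in H. destruct H as [H H'].
elimq (pb_pred_elim K).
apply (pb_pred_intro (d := y)); kj; eapply hom_ext_l; eassumption.
Qed.

Definition tt_pb : tt_ob R := tt_sub pb_pred_ext.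

Definition tt_pb1 : tt_hom HR tt_pb X.
Proof.
apply (@tt_graph C R HR tt_pb X (lpi1 _ _)).
intros G a b c H. apply tt_sub_spec, proj1, tt_prd_spec in H. apply H.
Defined.

Definition tt_pb2 : tt_hom HR tt_pb Y.
Proof.
apply (@tt_graph C R HR tt_pb Y (lpi2 _ _)).
intros G a b c H. apply tt_sub_spec, proj1, tt_prd_spec in H. apply H.
Defined.

Lemma tt_pb_is_pullback :
  @is_pullback (tripos_to_topos HR) X Y Z tt_pb f g tt_pb1 tt_pb2.
Proof.
split.
- apply (hom_eq (f := tt_comp f tt_pb1) (g := tt_comp g tt_pb2)).
  intros G a b c H. apply graph_comp_spec in H. destruct H as [H K].
  apply graph_comp_spec. split; [exact H |].
  apply tt_sub_spec, proj2 in H.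
  elimq (pb_pred_elim H).
  exact (hom_ext_r (hom_single H0 K) H1).
- intros W h k E.
  assert (Hl : forall (G : C) (a : Hom G (tt_car W)) b (c : R G),
    c ≤ ap (rel (tt_pair h k)) a b -> c ≤ reidx R b pb_pred).
  { intros G a b c H. apply pair_rel_spec in H. destruct H as [H K].
    tot f (hom_strict_r H).
    apply (pb_pred_intro (d := y)); kj; [exact M |].
    refine (proj1 (comp_spec (f := k) _ _ _) _); [eassumption |].
    change (tt_comp g k) with (@comp (tripos_to_topos HR) _ _ _ g k).
    rewrite <- E. exact (comp_intro H M). }
  exists (tt_lift pb_pred_ext Hl). split; [split |].
  + apply (hom_eq (f := tt_comp tt_pb1 (tt_lift pb_pred_ext Hl))).
    intros G a b c H. elimq (comp_elim H).
    apply tt_graph_spec in H1. apply pair_rel_spec in H0.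
    exact (hom_ext_r (proj2 H1) (proj1 H0)).
  + apply (hom_eq (f := tt_comp tt_pb2 (tt_lift pb_pred_ext Hl))).
    intros G a b c H. elimq (comp_elim H).
    apply tt_graph_spec in H1. apply pair_rel_spec in H0.
    exact (hom_ext_r (proj2 H1) (proj2 H0)).
  + intros u [<- <-]. symmetry. apply hom_eq.
    intros G a b c H. pose proof (hom_strict_r H) as K.
    apply tt_sub_spec in K. destruct K as [K _]. apply tt_prd_spec in K.
    apply pair_rel_spec.
    split; apply (comp_graph_spec _ _ H); apply K.
Qed.

End Pullback.

End FiniteLimits.

Ltac cc := cbn [tt_car tt_prd tt_sub tt_pb tt_one tt_ob_intro] in *.

(** * Monomorphisms, images and inverses *)

Section Monomorphisms.
Variables (C : lex_category) (R : lex_primary_doctrine C)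
  (HR : full_existential R).

Definition tt_limits : finite_limits (tripos_to_topos HR).
Proof.
apply (@FiniteLimits (tripos_to_topos HR) (tt_one R) (@tt_to_one _ _ HR)
  (@tt_to_one_uniq _ _ HR) (@tt_prd _ _) (@tt_pi1 _ _ HR) (@tt_pi2 _ _ HR)
  (@tt_pair _ _ HR)) with (pb := @tt_pb _ _ HR)
  (pb1 := @tt_pb1 _ _ HR) (pb2 := @tt_pb2 _ _ HR).
- intros X A B a b. apply (hom_eq (f := tt_comp (tt_pi1 HR A B) (tt_pair a b))).
  intros G x y c H. elimq (comp_elim H).
  apply tt_graph_spec in H1. apply pair_rel_spec in H0.
  exact (hom_ext_r (proj2 H1) (proj1 H0)).
- intros X A B a b. apply (hom_eq (f := tt_comp (tt_pi2 HR A B) (tt_pair a b))).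
  intros G x y c H. elimq (comp_elim H).
  apply tt_graph_spec in H1. apply pair_rel_spec in H0.
  exact (hom_ext_r (proj2 H1) (proj2 H0)).
- intros X A B u. apply (hom_eq (f := u)). intros G a b c H.
  pose proof (hom_strict_r H) as K. apply tt_prd_spec in K.
  apply pair_rel_spec. split; apply (comp_graph_spec _ _ H); apply K.
- intros. apply tt_pb_is_pullback.
Defined.

Definition tt_lex : lex_category := LexCategory tt_limits.

(** The two projections of the kernel pair of m coincide; they are evaluated at the element (a,
    a'). *)
Lemma mono_injective (X Y : tt_ob R) (m : tt_hom HR X Y) :
  @mono (tripos_to_topos HR) X Y m ->
  forall (G : C) (a a' : Hom G (tt_car X)) (b : Hom G (tt_car Y)) (c : R G),
    c ≤ ap (rel m) a b -> c ≤ ap (rel m) a' b -> c ≤ ap (tt_rel X) a a'.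
Proof.
intros Hm G a a' b c H K.
pose proof (Hm _ _ _ (proj1 (tt_pb_is_pullback m m))) as E.
assert (M : c ≤ ap (rel (tt_pb1 m m)) (lpair a a') a).
{ apply tt_graph_spec. cc. kj. split; [| exact (hom_strict_l H)].
  apply tt_sub_spec. split.
  - apply tt_prd_spec. kj. exact (conj (hom_strict_l H) (hom_strict_l K)).
  - apply (pb_pred_intro (d := b)); kj; assumption. }
rewrite E in M. apply tt_graph_spec, proj2 in M. cc. kj. exact (tt_rel_sym M).
Qed.

Lemma injective_mono (X Y : tt_ob R) (m : tt_hom HR X Y) :
  (forall (G : C) (a a' : Hom G (tt_car X)) (b : Hom G (tt_car Y)) (c : R G),
    c ≤ ap (rel m) a b -> c ≤ ap (rel m) a' b -> c ≤ ap (tt_rel X) a a') ->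
  @mono (tripos_to_topos HR) X Y m.
Proof.
intros Hm Z u v E. apply hom_eq. intros G a b c H.
tot m (hom_strict_r H).
assert (K : c0 ≤ ap (rel (tt_comp m v)) (a ∘ p) y).
{ change (tt_comp m v) with (@comp (tripos_to_topos HR) _ _ _ m v).
  rewrite <- E. exact (comp_intro H M). }
elimq (comp_elim K). exact (hom_ext_r (Hm _ _ _ _ _ H1 M) H0).
Qed.

(* ∃u. m(u, x) *)
Definition im (X Y : C) (m : R (lprd X Y)) : R Y :=
  exq HR (ap m (lpi2 _ _) (lpi1 _ _)).

Lemma im_intro (X Y : C) (m : R (lprd X Y)) (G : C) (a : Hom G X) (b : Hom G Y)
    (c : R G) :
  c ≤ ap m a b -> c ≤ reidx R b (im m).
Proof. intro H. apply (exq_intro HR (b := a)). kj. exact H. Qed.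

Lemma im_elim (X Y : C) (m : R (lprd X Y)) (G : C) (b : Hom G Y) (c e : R G) :
  c ≤ reidx R b (im m) ->
  (forall (G' : C) (p : Hom G' G) (a : Hom G' X) (c' : R G'),
     c' ≤ reidx R p c -> c' ≤ ap m a (b ∘ p) -> c' ≤ reidx R p e) ->
  c ≤ e.
Proof.
intros H K. apply (exq_elim H). intros G' p a c' L M. kj.
apply (K _ _ a _ L). exact M.
Qed.

Lemma im_strict (X Y : tt_ob R) (m : tt_hom HR X Y) (G : C)
    (b : Hom G (tt_car Y)) (c : R G) :
  c ≤ reidx R b (im (rel m)) -> c ≤ ap (tt_rel Y) b b.
Proof. intro H. elimq (im_elim H). exact (hom_strict_r H0). Qed.

Lemma im_ext (X Y : tt_ob R) (m : tt_hom HR X Y) :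
  ext_pred (X := Y) (im (rel m)).
Proof.
intros G a b c H K. elimq (im_elim K). apply (im_intro (a := y)).
exact (hom_ext_r H H0).
Qed.

(** The converse relation is functional: injectivity makes it single-valued and surjectivity makes
    it total. *)
Lemma bijective_inverse (X Y : tt_ob R) (f : tt_hom HR X Y) :
  (forall (G : C) (a a' : Hom G (tt_car X)) (b : Hom G (tt_car Y)) (c : R G),
    c ≤ ap (rel f) a b -> c ≤ ap (rel f) a' b -> c ≤ ap (tt_rel X) a a') ->
  (forall (G : C) (b : Hom G (tt_car Y)) (c : R G),
    c ≤ ap (tt_rel Y) b b -> c ≤ reidx R b (im (rel f))) ->
  exists g : tt_hom HR Y X,
    (forall (G : C) (a : Hom G (tt_car X)) (b : Hom G (tt_car Y)) (c : R G),
       c ≤ ap (rel g) b a <-> c ≤ ap (rel f) a b) /\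
    tt_comp g f = tt_id HR X /\ tt_comp f g = tt_id HR Y.
Proof.
intros Hi Hs.
assert (Hg : is_tt_arrow HR (X := Y) (Y := X)
  (ap (rel f) (lpi2 (tt_car Y) (tt_car X)) (lpi1 _ _))).
{ apply is_tt_arrow_intro; intros; kj.
  - exact (hom_strict_r H).
  - exact (hom_strict_l H).
  - exact (hom_ext_r H H0).
  - exact (hom_ext_l H H0).
  - exact (Hi _ _ _ _ _ H H0).
  - exact (Hs _ _ _ H). }
assert (E : forall (G : C) (a : Hom G (tt_car X)) (b : Hom G (tt_car Y)) (c : R G),
   c ≤ ap (ap (rel f) (lpi2 (tt_car Y) (tt_car X)) (lpi1 _ _)) b a <->
   c ≤ ap (rel f) a b).
{ intros. unfold ap. autorewrite with kj. reflexivity. }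
exists (exist _ _ Hg : tt_hom HR Y X). split; [exact E |].
split; apply hom_eq; intros G a b c H; elimq (comp_elim H).
- apply E in H1. exact (Hi _ _ _ _ _ H0 H1).
- apply E in H0. exact (hom_single H0 H1).
Qed.

End Monomorphisms.

(** * The topos of a doctrine *)

Section Topos.
Variables (C : lex_category) (R : lex_primary_doctrine C)
  (HR : full_existential R) (HO : higher_order R).

Lemma le_at (G G' A : C) (D : R A) (x : Hom G A) (q : Hom G' G) (c : R G)
    (c' : R G') :
  c' ≤ reidx R q c -> c ≤ reidx R x D -> c' ≤ reidx R (x ∘ q) D.
Proof. intros L H. rewrite reidx_comp. exact (le_reidx L H). Qed.

Lemma reidx_ap (G A B : C) (D : R (lprd A B)) (a : Hom G (lprd A B)) (c : R G) :
  c ≤ reidx R a D <-> c ≤ ap D (lpi1 A B ∘ a) (lpi2 A B ∘ a).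
Proof. rewrite <- ap_comp, ap_pi. reflexivity. Qed.

Lemma iffq_spec (G A B : C) (phi psi : R (lprd A B)) (a : Hom G A) (c : R G) :
  c ≤ reidx R a (iffq HO phi psi) <->
  (forall (G' : C) (p : Hom G' G) (b : Hom G' B) (c' : R G'),
     c' ≤ reidx R p c ->
     (c' ≤ ap phi (a ∘ p) b <-> c' ≤ ap psi (a ∘ p) b)).
Proof.
split; [| apply iffq_intro, HR].
intros H G' p b c' L. apply (iffq_elim (HO := HO)). exact (le_at L H).
Qed.

(** Along an identity, [fa] is plain implication. *)
Definition eqv (A : C) (phi psi : R A) : R A :=
  fa HO (idm A) phi psi ⊓ fa HO (idm A) psi phi.

Lemma eqv_spec (G A : C) (phi psi : R A) (a : Hom G A) (c : R G) :
  c ≤ reidx R a (eqv phi psi) <->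
  (forall (G' : C) (p : Hom G' G) (c' : R G'), c' ≤ reidx R p c ->
     (c' ≤ reidx R (a ∘ p) phi <-> c' ≤ reidx R (a ∘ p) psi)).
Proof.
unfold eqv. rewrite reidx_meet, le_meet_iff. split.
- intros [H K] G' p c' L. split; intro M; refine (fa_elim _ M);
    rewrite comp_idl; eapply le_at; eassumption.
- intro H. split; apply (fa_intro HR HO); intros G' p n c' E L;
    rewrite comp_idl in E; rewrite <- E; apply (H _ p c' L).
Qed.

(** Truth values are the subsets of the one-point object, so every predicate is named by an arrow
    into this object. *)
Definition prop_car : C := wpow HO (lone C).
Definition generic_pred : R prop_car :=
  reidx R (lpair (lto_one _) (idm _)) (wmem HO (lone C)).

Lemma generic_name (A : C) (D : R A) :
  exists d : Hom A prop_car, D = reidx R d generic_pred.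
Proof.
destruct (wname HO (reidx R (lpi2 (lone C) A) D)) as [d E]. exists d.
apply (f_equal (reidx R (lpair (lto_one A) (idm A)))) in E.
unfold generic_pred, lprd_map in *. autorewrite with kj in *. rewrite E.
f_equal. f_equal. symmetry. apply to_one_uniq.
Qed.

Definition tt_Omega : tt_ob R.
Proof.
apply (@tt_ob_intro C R prop_car
  (eqv (reidx R (lpi1 _ _) generic_pred) (reidx R (lpi2 _ _) generic_pred)));
  unfold ap; intros *.
- rewrite !eqv_spec. intros H G' p c' L. specialize (H _ p c' L). kj. tauto.
- rewrite !eqv_spec. intros H K G' p c' L.
  specialize (H _ p c' L). specialize (K _ p c' L). kj. tauto.
Defined.

Lemma tt_Omega_spec (G : C) (p q : Hom G prop_car) (c : R G) :
  c ≤ ap (tt_rel tt_Omega) p q <->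
  (forall (G' : C) (k : Hom G' G) (c' : R G'), c' ≤ reidx R k c ->
     (c' ≤ reidx R (p ∘ k) generic_pred <-> c' ≤ reidx R (q ∘ k) generic_pred)).
Proof.
unfold ap, tt_Omega. simpl. rewrite eqv_spec.
split; intros H G' k c' L; specialize (H _ k c' L); kj; exact H.
Qed.

Lemma tt_Omega_elim (G : C) (p q : Hom G prop_car) (c : R G) :
  c ≤ ap (tt_rel tt_Omega) p q -> c ≤ reidx R p generic_pred ->
  c ≤ reidx R q generic_pred.
Proof.
intros H. rewrite tt_Omega_spec in H. specialize (H _ (idm _) c). kj.
apply H, le_refl.
Qed.

Lemma tt_Omega_refl (G : C) (p : Hom G prop_car) (c : R G) :
  c ≤ ap (tt_rel tt_Omega) p p.
Proof. apply tt_Omega_spec. reflexivity. Qed.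

(** Strict and extensional predicates represent the subobjects of X. *)
Definition is_pred (X : tt_ob R) (D : R (tt_car X)) : Prop :=
  (forall (G : C) (a : Hom G (tt_car X)) (c : R G),
    c ≤ reidx R a D -> c ≤ ap (tt_rel X) a a) /\ ext_pred D.

Definition classify_rel (X : tt_ob R) (D : R (tt_car X)) :
    R (lprd (tt_car X) prop_car) :=
  ap (tt_rel X) (lpi1 _ _) (lpi1 _ _) ⊓
  eqv (reidx R (lpi2 _ _) generic_pred) (reidx R (lpi1 _ _) D).

Lemma classify_spec (X : tt_ob R) (D : R (tt_car X)) (G : C)
    (a : Hom G (tt_car X)) (p : Hom G prop_car) (c : R G) :
  c ≤ ap (classify_rel D) a p <->
  c ≤ ap (tt_rel X) a a /\
  (forall (G' : C) (k : Hom G' G) (c' : R G'), c' ≤ reidx R k c ->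
     (c' ≤ reidx R (p ∘ k) generic_pred <-> c' ≤ reidx R (a ∘ k) D)).
Proof.
unfold ap, classify_rel. rewrite reidx_meet, le_meet_iff, eqv_spec. kj.
split; intros [H K]; (split; [exact H |]); intros G' k c' L;
  specialize (K _ k c' L); kj; exact K.
Qed.

Definition classify (X : tt_ob R) (D : R (tt_car X)) (HD : is_pred D) :
  tt_hom HR X tt_Omega.
Proof.
exists (classify_rel D). apply is_tt_arrow_intro; intros *.
- rewrite classify_spec. tauto.
- intros _. apply tt_Omega_refl.
- rewrite !classify_spec. intros H [K M].
  split; [exact (tt_rel_trans (tt_rel_sym H) H) |].
  intros G' k c' L. rewrite (M _ k c' L). split; apply (proj2 HD).
  + exact (le_ap L H).
  + exact (le_ap L (tt_rel_sym H)).
- rewrite !classify_spec, tt_Omega_spec. intros H [K M]. split; [exact K |].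
  intros G' k c' L. rewrite <- (H _ k c' L). exact (M _ k c' L).
- rewrite !classify_spec, tt_Omega_spec. intros [_ H] [_ K] G' k c' L.
  rewrite (H _ k c' L), (K _ k c' L). reflexivity.
- intro H. destruct (generic_name D) as [d E].
  apply (ex_pi1_intro HR (b := d ∘ a)). apply classify_spec.
  split; [exact H |]. intros G' k c' L. rewrite E. kj. reflexivity.
Defined.

Definition pred_of (X : tt_ob R) (f : tt_hom HR X tt_Omega) : R (tt_car X) :=
  exq HR (rel f ⊓ reidx R (lpi2 _ _) generic_pred).

Section PredOf.
Variables (X : tt_ob R) (f : tt_hom HR X tt_Omega).

Lemma pred_of_spec (G : C) (a : Hom G (tt_car X)) (p : Hom G prop_car) (c : R G) :
  c ≤ ap (rel f) a p -> (c ≤ reidx R a (pred_of f) <-> c ≤ reidx R p generic_pred).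
Proof.
intro H. split; intro K.
- elimq (exq_elim K).
  exact (tt_Omega_elim (hom_single H0 H) H1).
- apply (exq_intro HR (b := p)). kj; assumption.
Qed.

Lemma pred_of_is_pred : is_pred (pred_of f).
Proof.
split.
- intros G a c H. elimq (exq_elim H).
  exact (hom_strict_l H0).
- intros G a b c H K. tot f (tt_rel_trans H (tt_rel_sym H)).
  pose proof (hom_ext_l H M) as N.
  apply (pred_of_spec N). apply (pred_of_spec M), K.
Qed.

End PredOf.

Lemma pred_of_comp (X Y : tt_ob R) (f : tt_hom HR X Y) (g : tt_hom HR Y tt_Omega)
    (G : C) (a : Hom G (tt_car X)) (b : Hom G (tt_car Y)) (c : R G) :
  c ≤ ap (rel f) a b ->
  (c ≤ reidx R a (pred_of (tt_comp g f)) <-> c ≤ reidx R b (pred_of g)).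
Proof.
intro H.
split; intro K; tot g (hom_strict_r H);
  pose proof (comp_intro H M) as N.
- apply (pred_of_spec M), (pred_of_spec N), K.
- apply (pred_of_spec N), (pred_of_spec M), K.
Qed.

(** Equality on Ω is bi-implication. This reduces every equation between arrows into Ω below,
    including the axioms of a topology, to entailments at existing elements. *)
Lemma pred_of_inj (X : tt_ob R) (f g : tt_hom HR X tt_Omega) :
  (forall (G : C) (a : Hom G (tt_car X)) (c : R G), c ≤ ap (tt_rel X) a a ->
    (c ≤ reidx R a (pred_of f) <-> c ≤ reidx R a (pred_of g))) -> f = g.
Proof.
intro E. apply hom_eq. intros G a p c H.
tot g (hom_strict_l H). refine (hom_ext_r (b := y) _ M).
apply tt_Omega_spec. intros G' k c' L'.
shift L'. rewrite <- (pred_of_spec M), <- (pred_of_spec H), E; [reflexivity |].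
exact (hom_strict_l H).
Qed.

Lemma pred_of_classify (X : tt_ob R) (D : R (tt_car X)) (HD : is_pred D) (G : C)
    (a : Hom G (tt_car X)) (c : R G) :
  c ≤ reidx R a (pred_of (classify HD)) <-> c ≤ reidx R a D.
Proof.
split; intro H.
- pose proof (proj1 (pred_of_is_pred _) _ _ _ H) as K.
  tot (classify HD) K. apply (pred_of_spec M) in H.
  apply (proj1 (classify_spec _ _ _ _)), proj2 in M.
  specialize (M _ (idm _) c0). kj. apply M; [apply le_refl | exact H].
- tot (classify HD) (proj1 HD _ _ _ H). apply (pred_of_spec M).
  apply (proj1 (classify_spec _ _ _ _)), proj2 in M.
  specialize (M _ (idm _) c0). kj. apply M; [apply le_refl | exact H].
Qed.

Lemma le_top_at (G A : C) (a : Hom G A) (c : R G) : c ≤ reidx R a top.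
Proof. rewrite reidx_top. apply le_top. Qed.

Lemma top_is_pred : is_pred (X := tt_one R) top.
Proof.
split; repeat intro; [apply tt_one_rel | apply le_top_at].
Qed.

Definition tt_true : tt_hom HR (tt_one R) tt_Omega := classify top_is_pred.

Lemma eq_true (X : tt_ob R) (f : tt_hom HR X tt_Omega) (b : tt_hom HR X (tt_one R)) :
  f = tt_comp tt_true b <->
  (forall (G : C) (a : Hom G (tt_car X)) (c : R G), c ≤ ap (tt_rel X) a a ->
     c ≤ reidx R a (pred_of f)).
Proof.
assert (K : forall (G : C) (a : Hom G (tt_car X)) (c : R G),
  c ≤ ap (tt_rel X) a a -> c ≤ reidx R a (pred_of (tt_comp tt_true b))).
{ intros G a c H. tot b H. apply (pred_of_comp _ M), pred_of_classify.
  apply le_top_at. }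
split.
- intros ->. exact K.
- intro H. apply pred_of_inj. intros G a c L.
  split; intros _; [apply K, L | apply H, L].
Qed.

Lemma im_is_pred (X Y : tt_ob R) (m : tt_hom HR X Y) :
  is_pred (X := Y) (im HR (rel m)).
Proof. split; [apply im_strict | apply im_ext]. Qed.

Definition tt_chi (U X : tt_ob R) (m : tt_hom HR U X) : tt_hom HR X tt_Omega :=
  classify (im_is_pred m).

Lemma tt_chi_pullback (U X : tt_ob R) (m : tt_hom HR U X) :
  @mono (tripos_to_topos HR) U X m ->
  @is_pullback (tripos_to_topos HR) X (tt_one R) tt_Omega U (tt_chi m) tt_true m
    (tt_to_one HR U).
Proof.
intro Hm. pose proof (mono_injective Hm) as Hi. split.
- apply (eq_true (tt_comp (tt_chi m) m)). intros G a c H.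
  tot m H. apply (pred_of_comp _ M), pred_of_classify.
  exact (im_intro HR M).
- intros Y a b E. pose proof (proj1 (eq_true (tt_comp (tt_chi m) a) b) E) as K.
  assert (K' : forall G y x (c : R G), c ≤ ap (rel a) y x ->
    c ≤ reidx R x (im HR (rel m))).
  { intros G y x c H. apply (pred_of_classify (im_is_pred m)).
    apply (pred_of_comp (tt_chi m) H), K. exact (hom_strict_l H). }
  (* The mediating arrow is the converse of m after a: single-valued because m is injective, total
     because a takes its values in the image of m. *)
  assert (Hu : is_tt_arrow HR (X := Y) (Y := U)
    (rel_comp HR (ap (rel m) (lpi2 (tt_car X) (tt_car U)) (lpi1 _ _)) (rel a))).
  { apply is_tt_arrow_intro; intros.
    - elimq (rel_comp_elim H). exact (hom_strict_l H0).
    - elimq (rel_comp_elim H). exact (hom_strict_l H1).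
    - elimq (rel_comp_elim H0). apply (rel_comp_intro HR (b := y)); kj;
        [exact (hom_ext_l H H1) | exact H2].
    - elimq (rel_comp_elim H0). apply (rel_comp_intro HR (b := y)); kj;
        [exact H1 | exact (hom_ext_l H H2)].
    - elimq (rel_comp_elim H). elimq (rel_comp_elim H0).
      exact (Hi _ _ _ _ _ (hom_ext_r (hom_single H1 H3) H2) H4).
    - tot a H. pose proof (K' _ _ _ _ M) as N. elimq (im_elim N).
      apply (ex_pi1_intro HR (b := y0)).
      apply (rel_comp_intro HR (b := y ∘ p0)); kj; assumption. }
  exists (exist _ _ Hu : tt_hom HR Y U). split; [split |].
  + apply (hom_eq (f := tt_comp m (exist _ _ Hu : tt_hom HR Y U))).
    intros G y x c H. elimq (comp_elim H). elimq (rel_comp_elim H0).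
    exact (hom_ext_r (hom_single H3 H1) H2).
  + rewrite (tt_to_one_uniq b). apply tt_to_one_uniq.
  + intros v [<- _]. symmetry. apply hom_eq. intros G y u c H.
    tot m (hom_strict_r H).
    apply (rel_comp_intro HR (b := y0)); [| kj; exact M].
    exact (comp_intro H M).
Qed.

Lemma tt_chi_uniq (U X : tt_ob R) (m : tt_hom HR U X) (f : tt_hom HR X tt_Omega) :
  @is_pullback (tripos_to_topos HR) X (tt_one R) tt_Omega U f tt_true m
    (tt_to_one HR U) -> f = tt_chi m.
Proof.
intros [E K]. apply pred_of_inj. intros G a c Ha.
unfold tt_chi. rewrite pred_of_classify. split; intro H.
(* The subobject cut out by f is sent to true by f, so its inclusion factors through m, and its
   elements lie in the image of m. *)
- destruct (K _ (tt_incl HR (proj2 (pred_of_is_pred f))) (tt_to_one HR _))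
    as (u & [Eu _] & _).
  { apply (eq_true (tt_comp f (tt_incl HR (proj2 (pred_of_is_pred f))))).
    intros G' b c' M. apply tt_sub_spec in M.
    pose proof (proj2 (tt_incl_spec HR (proj2 (pred_of_is_pred f)) _ _ _) M) as N.
    apply (pred_of_comp f N), M. }
  pose proof (proj2 (tt_incl_spec HR (proj2 (pred_of_is_pred f)) _ _ _)
    (conj Ha H)) as N.
  rewrite <- Eu in N. elimq (comp_elim N). exact (im_intro HR H1).
- elimq (im_elim H). apply (pred_of_comp f H0).
  exact (proj1 (eq_true (tt_comp f m) _) E _ _ _ (hom_strict_l H0)).
Qed.

(** * Power objects *)

Section Power.
Variable B : tt_ob R.

(* The closure of the weak membership predicate under the equality of B, so
   that every element of the weak power object names a subobject of B. *)
Definition pmem : R (lprd (tt_car B) (wpow HO (tt_car B))) :=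
  exq HR (ap (tt_rel B) (lpi1 _ _ ∘ lpi1 _ _) (lpi2 _ (tt_car B)) ⊓
          ap (wmem HO (tt_car B)) (lpi2 _ _) (lpi2 _ _ ∘ lpi1 _ _)).

Lemma pmem_intro (G : C) (b b' : Hom G (tt_car B)) U (c : R G) :
  c ≤ ap (tt_rel B) b b' -> c ≤ ap (wmem HO (tt_car B)) b' U ->
  c ≤ ap pmem b U.
Proof. intros. apply (exq_intro HR (b := b')). kj; assumption. Qed.

Lemma pmem_elim (G : C) (b : Hom G (tt_car B)) U (c e : R G) :
  c ≤ ap pmem b U ->
  (forall (G' : C) (p : Hom G' G) (b' : Hom G' (tt_car B)) (c' : R G'),
     c' ≤ reidx R p c -> c' ≤ ap (tt_rel B) (b ∘ p) b' ->
     c' ≤ ap (wmem HO (tt_car B)) b' (U ∘ p) -> c' ≤ reidx R p e) ->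
  c ≤ e.
Proof.
intros H K. apply (exq_elim H). intros G' p b' c' L M. kj.
apply (K _ _ b' _ L); assumption.
Qed.

Lemma pmem_strict (G : C) (b : Hom G (tt_car B)) U (c : R G) :
  c ≤ ap pmem b U -> c ≤ ap (tt_rel B) b b.
Proof.
intro H. elimq (pmem_elim H). exact (tt_rel_trans H0 (tt_rel_sym H0)).
Qed.

Lemma pmem_ext (G : C) (b b' : Hom G (tt_car B)) U (c : R G) :
  c ≤ ap (tt_rel B) b b' -> c ≤ ap pmem b U -> c ≤ ap pmem b' U.
Proof.
intros H K. elimq (pmem_elim K).
exact (pmem_intro (tt_rel_trans (tt_rel_sym H) H0) H1).
Qed.

(** A weak name of D still names it for [pmem], because a relation that is strict and extensional in
    B is unchanged by closing it under the equality of B. *)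
Lemma pmem_name (Y : C) (D : R (lprd (tt_car B) Y)) :
  (forall G (b : Hom G (tt_car B)) (y : Hom G Y) (c : R G),
     c ≤ ap D b y -> c ≤ ap (tt_rel B) b b) ->
  (forall G (b b' : Hom G (tt_car B)) (y : Hom G Y) (c : R G),
     c ≤ ap (tt_rel B) b b' -> c ≤ ap D b y -> c ≤ ap D b' y) ->
  exists d : Hom Y (wpow HO (tt_car B)),
    forall G (b : Hom G (tt_car B)) (y : Hom G Y) (c : R G),
      c ≤ ap pmem b (d ∘ y) <-> c ≤ ap D b y.
Proof.
intros Hs He. destruct (wname HO D) as [d E]. exists d.
assert (K : forall G (b : Hom G (tt_car B)) (y : Hom G Y) (c : R G),
  c ≤ ap (wmem HO (tt_car B)) b (d ∘ y) <-> c ≤ ap D b y).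
{ intros. rewrite E. unfold ap, lprd_map. autorewrite with kj. reflexivity. }
intros G b y c. split; intro H.
- elimq (pmem_elim H). apply K in H1. exact (He _ _ _ _ _ (tt_rel_sym H0) H1).
- apply (pmem_intro (Hs _ _ _ _ H)). apply K, H.
Qed.

Definition tt_pow : tt_ob R.
Proof.
apply (@tt_ob_intro C R (wpow HO (tt_car B))
  (iffq HO (ap pmem (lpi2 _ (tt_car B)) (lpi1 _ _ ∘ lpi1 _ _))
           (ap pmem (lpi2 _ (tt_car B)) (lpi2 _ _ ∘ lpi1 _ _))));
  unfold ap; intros *.
- rewrite !iffq_spec. intros H G' p b' c' L. specialize (H _ p b' c' L). kj. tauto.
- rewrite !iffq_spec. intros H K G' p b' c' L.
  specialize (H _ p b' c' L). specialize (K _ p b' c' L). kj. tauto.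
Defined.

Lemma tt_pow_spec (G : C) (U V : Hom G (wpow HO (tt_car B))) (c : R G) :
  c ≤ ap (tt_rel tt_pow) U V <->
  (forall (G' : C) (p : Hom G' G) (b : Hom G' (tt_car B)) (c' : R G'),
     c' ≤ reidx R p c -> (c' ≤ ap pmem b (U ∘ p) <-> c' ≤ ap pmem b (V ∘ p))).
Proof.
unfold ap at 1. simpl. rewrite iffq_spec.
split; intros H G' k b c' L; specialize (H _ k b c' L); kj; exact H.
Qed.

Lemma tt_pow_refl (G : C) (U : Hom G (wpow HO (tt_car B))) (c : R G) :
  c ≤ ap (tt_rel tt_pow) U U.
Proof. apply tt_pow_spec. reflexivity. Qed.

Lemma tt_pow_elim (G : C) (b : Hom G (tt_car B)) (U V : Hom G (wpow HO (tt_car B)))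
    (c : R G) :
  c ≤ ap (tt_rel tt_pow) U V -> c ≤ ap pmem b U -> c ≤ ap pmem b V.
Proof.
intro H. rewrite tt_pow_spec in H. specialize (H _ (idm _) b c). kj.
apply H, le_refl.
Qed.

Lemma pmem_is_pred : is_pred (X := tt_prd B tt_pow) pmem.
Proof.
split.
- intros G a c H. apply tt_prd_spec. split; [| apply tt_pow_refl].
  apply reidx_ap in H. exact (pmem_strict H).
- intros G a b c H K. apply tt_prd_spec in H. destruct H as [H M].
  apply reidx_ap. apply reidx_ap in K.
  exact (tt_pow_elim M (pmem_ext H K)).
Qed.

Definition tt_mem : tt_hom HR (tt_prd B tt_pow) tt_Omega := classify pmem_is_pred.

Variable A : tt_ob R.

Definition transpose_rel (D : R (lprd (tt_car B) (tt_car A))) :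
    R (lprd (tt_car A) (wpow HO (tt_car B))) :=
  ap (tt_rel A) (lpi1 _ _) (lpi1 _ _) ⊓
  iffq HO (ap pmem (lpi2 _ (tt_car B)) (lpi2 _ _ ∘ lpi1 _ _))
          (ap D (lpi2 _ (tt_car B)) (lpi1 _ _ ∘ lpi1 _ _)).

Lemma transpose_spec D (G : C) (a : Hom G (tt_car A)) U (c : R G) :
  c ≤ ap (transpose_rel D) a U <->
  c ≤ ap (tt_rel A) a a /\
  (forall (G' : C) (p : Hom G' G) (b : Hom G' (tt_car B)) (c' : R G'),
     c' ≤ reidx R p c -> (c' ≤ ap pmem b (U ∘ p) <-> c' ≤ ap D b (a ∘ p))).
Proof.
unfold ap at 1, transpose_rel. rewrite reidx_meet, le_meet_iff, iffq_spec. kj.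
split; intros [H K]; (split; [exact H |]); intros G' k b c' L;
  specialize (K _ k b c' L); kj; exact K.
Qed.

Variable D : R (lprd (tt_car B) (tt_car A)).
Hypothesis Dp : is_pred (X := tt_prd B A) D.

Lemma bipred_strict (G : C) (b : Hom G (tt_car B)) (a : Hom G (tt_car A)) (c : R G) :
  c ≤ ap D b a -> c ≤ ap (tt_rel B) b b /\ c ≤ ap (tt_rel A) a a.
Proof.
intro H. pose proof (proj1 Dp _ _ _ H) as K. apply tt_prd_spec in K.
cc. kj. exact K.
Qed.

Lemma bipred_ext (G : C) (b b' : Hom G (tt_car B)) (a a' : Hom G (tt_car A)) (c : R G) :
  c ≤ ap (tt_rel B) b b' -> c ≤ ap (tt_rel A) a a' -> c ≤ ap D b a ->
  c ≤ ap D b' a'.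
Proof.
intros H K M. refine (proj2 Dp _ _ (lpair b' a') _ _ M).
apply tt_prd_spec. cc. kj. exact (conj H K).
Qed.

Lemma transpose_at (G : C) (b : Hom G (tt_car B)) (a : Hom G (tt_car A)) U
    (c : R G) :
  c ≤ ap (transpose_rel D) a U -> (c ≤ ap pmem b U <-> c ≤ ap D b a).
Proof.
intro H. apply transpose_spec, proj2 in H. specialize (H _ (idm _) b c).
kj. apply H, le_refl.
Qed.

Definition transpose : tt_hom HR A tt_pow.
Proof.
exists (transpose_rel D). apply is_tt_arrow_intro; intros *.
- rewrite transpose_spec. tauto.
- intros _. apply tt_pow_refl.
- rewrite !transpose_spec. intros H [K M].
  split; [exact (tt_rel_trans (tt_rel_sym H) H) |].
  intros G' k d c' L. rewrite (M _ k d c' L). split; intro N.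
  + exact (bipred_ext (proj1 (bipred_strict N)) (le_ap L H) N).
  + exact (bipred_ext (proj1 (bipred_strict N)) (le_ap L (tt_rel_sym H)) N).
- rewrite !transpose_spec, tt_pow_spec. intros H [K M]. split; [exact K |].
  intros G' k d c' L. rewrite <- (H _ k d c' L). exact (M _ k d c' L).
- rewrite !transpose_spec, tt_pow_spec. intros [_ H] [_ K] G' k d c' L.
  rewrite (H _ k d c' L), (K _ k d c' L). reflexivity.
(* The value at a is d(a), for an arrow d naming D. *)
- intro H. destruct (pmem_name (D := D)) as [d E].
  + intros G' b a' c' K. apply (bipred_strict K).
  + intros G' b b' a' c' K M.
    exact (bipred_ext K (proj2 (bipred_strict M)) M).
  + apply (ex_pi1_intro HR (b := d ∘ a)). apply transpose_spec.
    split; [exact H |]. intros G' k b' c' L. rewrite <- comp_assoc. apply E.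
Defined.

End Power.

Lemma prd_map_intro (A A' B B' : tt_ob R) (f : tt_hom HR B B')
    (g : tt_hom HR A A') (G : C) (z : Hom G (lprd (tt_car B) (tt_car A)))
    (b' : Hom G (tt_car B')) (a' : Hom G (tt_car A')) (c : R G) :
  c ≤ ap (rel f) (lpi1 _ _ ∘ z) b' -> c ≤ ap (rel g) (lpi2 _ _ ∘ z) a' ->
  c ≤ ap (rel (@lprd_map (tt_lex HR) B A B' A' f g : tt_hom HR _ _))
    z (lpair b' a').
Proof.
intros H K.
assert (M : c ≤ ap (tt_rel (tt_prd B A)) z z).
{ apply tt_prd_spec. exact (conj (hom_strict_l H) (hom_strict_l K)). }
apply pair_rel_spec. cc. rewrite lpi1_pair, lpi2_pair. split.
- apply (comp_intro (f := tt_pi1 HR B A) (g := f) (b := lpi1 _ _ ∘ z)).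
  + apply tt_graph_spec. exact (conj M (hom_strict_l H)).
  + exact H.
- apply (comp_intro (f := tt_pi2 HR B A) (g := g) (b := lpi2 _ _ ∘ z)).
  + apply tt_graph_spec. exact (conj M (hom_strict_l K)).
  + exact K.
Qed.

Lemma tt_transpose (A B : tt_ob R) (f : tt_hom HR (tt_prd B A) tt_Omega) :
  exists! g : tt_hom HR A (tt_pow B),
    f = tt_comp (tt_mem B) (@lprd_map (tt_lex HR) B A B (tt_pow B) (tt_id HR B) g).
Proof.
(* The composite with membership holds at (b, a) exactly when b belongs to the value of g at a;
   existence and uniqueness of the transpose are both read off from this. *)
assert (K : forall g : tt_hom HR A (tt_pow B),
  forall G z U (c : R G), c ≤ ap (tt_rel (tt_prd B A)) z z ->
    c ≤ ap (rel g) (lpi2 _ _ ∘ z) U ->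
    (c ≤ reidx R z (pred_of (tt_comp (tt_mem B)
        (@lprd_map (tt_lex HR) B A B (tt_pow B) (tt_id HR B) g))) <->
     c ≤ ap (pmem B) (lpi1 _ _ ∘ z) U)).
{ intros g G z U c H M. apply tt_prd_spec in H.
  rewrite (pred_of_comp _ (prd_map_intro (f := tt_id HR B) (proj1 H) M)).
  apply (pred_of_classify (pmem_is_pred B)). }
exists (transpose (pred_of_is_pred f)). split.
- apply pred_of_inj. intros G z c H.
  pose proof (proj2 (proj1 (tt_prd_spec _ _ _) H)) as M.
  split; intro N; tot (transpose (pred_of_is_pred f)) M.
  + apply (K _ _ _ _ _ H M0). apply (transpose_at _ M0).
    apply (proj1 (reidx_ap _ _ _)) in N. exact N.
  + apply reidx_ap. apply (transpose_at _ M0). exact (proj1 (K _ _ _ _ _ H M0) N).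
- intros g E. symmetry. apply hom_eq. intros G a U c H.
  apply transpose_spec. split; [exact (hom_strict_l H) |].
  intros G' p b c' L. shift L.
  assert (M : c' ≤ ap (tt_rel B) b b ->
    (c' ≤ ap (pred_of f) b (a ∘ p) <-> c' ≤ ap (pmem B) b (U ∘ p))).
  { intro M. unfold ap at 1. rewrite E.
    rewrite (K g _ (lpair b (a ∘ p)) (U ∘ p)).
    - kj. reflexivity.
    - apply tt_prd_spec. kj. exact (conj M (hom_strict_l H)).
    - kj. exact H. }
  split; intro N.
  + apply M; [exact (pmem_strict N) | exact N].
  + apply M; [| exact N].
    exact (proj1 (bipred_strict (pred_of_is_pred f) N)).
Qed.

Definition tt_topos : elementary_topos (tripos_to_topos HR).
Proof.
apply (@ElementaryTopos (tripos_to_topos HR) (tt_limits HR) tt_Omega tt_true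
  (fun U X m _ => tt_chi m)) with (pow := tt_pow) (mem := tt_mem).
- intros U X m Hm. exact (tt_chi_pullback Hm).
- intros U X m _ c. apply tt_chi_uniq.
- intros A B f. exact (tt_transpose f).
Defined.

End Topos.

(** * The topology of an inclusion of doctrines *)

(* di includes P fibrewise in R and dl is its left adjoint. *)
Record doctrine_inclusion (C : lex_category) (P R : lex_primary_doctrine C) :=
  DoctrineInclusion {
  dl : forall A : C, R A -> P A;
  di : forall A : C, P A -> R A;
  dl_adj : forall (A : C) (x : R A) (y : P A), dl x ≤ y <-> x ≤ di y;
  dl_di : forall (A : C) (y : P A), dl (di y) = y;
  dl_meet : forall (A : C) (x y : R A), dl (x ⊓ y) = dl x ⊓ dl y;
  dl_reidx : forall (A B : C) (f : Hom A B) (x : R B),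
    dl (reidx R f x) = reidx P f (dl x);
  di_reidx : forall (A B : C) (f : Hom A B) (y : P B),
    di (reidx P f y) = reidx R f (di y)
}.

Section Inclusion.
Variables (C : lex_category) (P R : lex_primary_doctrine C)
  (HP : full_existential P) (HR : full_existential R) (HO : higher_order R)
  (I : doctrine_inclusion P R).

Lemma dl_mono (A : C) (x y : R A) : x ≤ y -> dl I x ≤ dl I y.
Proof. intro H. rewrite (le_meetP H), dl_meet. apply meet_ler. Qed.

Lemma di_mono (A : C) (x y : P A) : x ≤ y -> di I x ≤ di I y.
Proof. intro H. apply dl_adj. rewrite dl_di. exact H. Qed.

Lemma di_meet (A : C) (x y : P A) : di I (x ⊓ y) = di I x ⊓ di I y.
Proof.
apply le_antisym.
- apply meet_glb; apply di_mono; [apply meet_lel | apply meet_ler].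
- apply dl_adj. rewrite dl_meet, !dl_di. apply le_refl.
Qed.

(** Both sides are left adjoint to the same map, since [di] commutes with reindexing. *)
Lemma dl_ex (A B : C) (f : Hom A B) (x : R A) :
  dl I (ex HR f x) = ex HP f (dl I x).
Proof.
apply le_antisym.
- apply dl_adj, (ex_adj HR). rewrite <- di_reidx. apply dl_adj.
  apply (ex_adj HP), le_refl.
- apply (ex_adj HP). rewrite <- dl_reidx. apply dl_mono, (ex_adj HR), le_refl.
Qed.

Lemma dl_at (G A : C) (x : R A) (a : Hom G A) (c : R G) :
  c ≤ reidx R a x -> dl I c ≤ reidx P a (dl I x).
Proof. rewrite <- dl_reidx. apply dl_mono. Qed.

Lemma dl_ap (G A B : C) (x : R (lprd A B)) (a : Hom G A) (b : Hom G B) (c : R G) :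
  c ≤ ap x a b -> dl I c ≤ ap (dl I x) a b.
Proof. apply dl_at. Qed.

Lemma di_at (G A : C) (x : P A) (a : Hom G A) (c : R G) :
  c ≤ reidx R a (di I x) <-> dl I c ≤ reidx P a x.
Proof. rewrite <- di_reidx. symmetry. apply dl_adj. Qed.

Definition cl (A : C) (x : R A) : R A := di I (dl I x).

Lemma cl_intro (G A : C) (x : R A) (a : Hom G A) (c : R G) :
  c ≤ reidx R a x -> c ≤ reidx R a (cl x).
Proof. intro H. apply di_at, dl_at, H. Qed.

(** Elimination rule of the modality: towards a closed goal, x may be assumed in place of its
    closure. As [dl] preserves meets, c and its meet with x(a) have the same image in P. The premise
    carries an identity reindexing so that [shift] applies to it. *)
Lemma cl_elim (G A B : C) (x : R A) (y : R B) (a : Hom G A) (b : Hom G B) (c : R G) :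
  c ≤ reidx R a (cl x) ->
  (forall c' : R G, c' ≤ reidx R (idm G) c -> c' ≤ reidx R a x ->
     c' ≤ reidx R b (cl y)) ->
  c ≤ reidx R b (cl y).
Proof.
intros H K. apply di_at. apply di_at in H.
assert (M : dl I (c ⊓ reidx R a x) ≤ reidx P b (dl I y)).
{ apply di_at, K; [rewrite reidx_id; apply meet_lel | apply meet_ler]. }
apply (fun h => le_trans _ h M). rewrite dl_meet, dl_reidx.
apply meet_glb; [apply le_refl | exact H].
Qed.

Lemma cl_ext (X : tt_ob R) (D : R (tt_car X)) : ext_pred D -> ext_pred (cl D).
Proof.
intros HD G a b c H K. apply (cl_elim K). intros c' L M. shift L.
apply cl_intro. exact (HD _ _ _ _ H M).
Qed.

Lemma cl_generic_is_pred : is_pred (X := tt_Omega HR HO) (cl (generic_pred HO)).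
Proof.
split; [intros; apply tt_Omega_refl |].
apply cl_ext. intros G a b c. apply tt_Omega_elim.
Qed.

Definition cl_j : tt_hom HR (tt_Omega HR HO) (tt_Omega HR HO) :=
  classify HR HO cl_generic_is_pred.

(** Composing with j closes the classified predicate. The element is asked to exist because the
    closure of a strict predicate need not be strict. *)
Lemma pred_of_cl (X : tt_ob R) (f : tt_hom HR X (tt_Omega HR HO)) (G : C)
    (a : Hom G (tt_car X)) (c : R G) :
  c ≤ ap (tt_rel X) a a ->
  (c ≤ reidx R a (pred_of (tt_comp cl_j f)) <-> c ≤ reidx R a (cl (pred_of f))).
Proof.
intro H. split; intro K; tot f H; pose proof (pred_of_comp cl_j M) as N.
- apply N, pred_of_classify in K. apply (cl_elim K). intros c' L' K'.
  shift L'. apply cl_intro. apply (pred_of_spec M), K'.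
- apply N, pred_of_classify. apply (cl_elim K). intros c' L' K'.
  shift L'. apply cl_intro. apply (pred_of_spec M), K'.
Qed.

(** [Omega_meet] of [tt_topos] unfolds to this arrow. *)
Definition tt_meet :
    tt_hom HR (tt_prd (tt_Omega HR HO) (tt_Omega HR HO)) (tt_Omega HR HO) :=
  tt_chi HO (tt_pair (tt_true HR HO) (tt_true HR HO)).

Lemma pred_of_meet (G : C) (z : Hom G (lprd (prop_car HO) (prop_car HO))) (c : R G) :
  c ≤ reidx R z (pred_of tt_meet) <->
  c ≤ reidx R (lpi1 _ _ ∘ z) (generic_pred HO) /\
  c ≤ reidx R (lpi2 _ _ ∘ z) (generic_pred HO).
Proof.
assert (T : forall G' (u : Hom G' (lone C)) p (c' : R G'),
  c' ≤ ap (rel (tt_true HR HO)) u p <-> c' ≤ reidx R p (generic_pred HO)).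
{ intros G' u p c'.
  split; intro H.
  - apply (proj1 (classify_spec HR (X := tt_one R) _ _ _ _)), proj2 in H.
    specialize (H _ (idm _) c'). kj.
    apply H; [apply le_refl | apply le_top_at].
  - apply (classify_spec HR (X := tt_one R)). split; [apply tt_one_rel |].
    intros G'' k c'' L.
    split; intros _; [apply le_top_at | exact (le_at L H)]. }
refine (iff_trans (pred_of_classify HR HO
  (im_is_pred (tt_pair (tt_true HR HO) (tt_true HR HO))) z c) _). split.
- intro H. split; elimq (im_elim H); apply pair_rel_spec in H0;
    destruct H0 as [K K0]; apply T in K; apply T in K0; kj; assumption.
- intros [H K]. apply (im_intro HR (a := lto_one G)).
  apply pair_rel_spec. rewrite !T. exact (conj H K).
Qed.

(** Conjunction enters only through its predicate; the entailments then say that the closure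
    preserves binary meets. *)
Lemma cl_j_meet
    (f : tt_hom HR (tt_prd (tt_Omega HR HO) (tt_Omega HR HO)) (tt_Omega HR HO)) :
  (forall (G : C) (z : Hom G (lprd (prop_car HO) (prop_car HO))) (c : R G),
     c ≤ reidx R z (pred_of f) <->
     c ≤ reidx R (lpi1 _ _ ∘ z) (generic_pred HO) /\
     c ≤ reidx R (lpi2 _ _ ∘ z) (generic_pred HO)) ->
  tt_comp cl_j f = tt_comp f (@lprd_map (tt_lex HR) (tt_Omega HR HO) (tt_Omega HR HO)
    (tt_Omega HR HO) (tt_Omega HR HO) cl_j cl_j).
Proof.
intro Hf. apply pred_of_inj. intros G z c H. rewrite (pred_of_cl _ H).
pose proof (proj1 (tt_prd_spec _ _ _) H) as [H1 H2]. clear H.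
split; intro K; tot cl_j H1; tot cl_j H2;
  pose proof (pred_of_comp f (prd_map_intro M M0)) as N.
- apply N, Hf. rewrite lpi1_pair, lpi2_pair. split.
  + apply (pred_of_spec M), pred_of_classify. apply (cl_elim K).
    intros c' L' K'. apply Hf, proj1 in K'. apply cl_intro, K'.
  + apply (pred_of_spec M0), pred_of_classify. apply (cl_elim K).
    intros c' L' K'. apply Hf, proj2 in K'. apply cl_intro, K'.
- apply N, Hf in K. rewrite lpi1_pair, lpi2_pair in K. destruct K as [K1 K2].
  apply (pred_of_spec M), pred_of_classify in K1.
  apply (pred_of_spec M0), pred_of_classify in K2.
  apply (cl_elim K1). intros c' L' K1'. shift L'.
  apply (cl_elim K2). intros c'' L'' K2'. shift L''.
  apply cl_intro, Hf. exact (conj K1' K2').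
Qed.

Definition cl_topology : lawvere_tierney (tt_topos HR HO).
Proof.
apply (@LawvereTierney _ (tt_topos HR HO) cl_j).
- apply (pred_of_inj (f := tt_comp cl_j (tt_true HR HO))).
  intros G a c H. rewrite (pred_of_cl _ H).
  assert (K : c ≤ reidx R a (pred_of (tt_true HR HO))).
  { apply pred_of_classify, le_top_at. }
  split; intros _; [exact K | apply cl_intro, K].
- apply (pred_of_inj (f := tt_comp cl_j cl_j)).
  intros G a c H. rewrite (pred_of_cl _ H).
  split; intro K.
  + apply pred_of_classify. apply (cl_elim K). intros c' L M.
    apply pred_of_classify in M. exact M.
  + apply cl_intro, K.
- exact (cl_j_meet pred_of_meet).
Defined.

Lemma dense_spec (U X : tt_ob R) (m : tt_hom HR U X) :
  dense (E := tt_topos HR HO) cl_topology m <->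
  @mono (tripos_to_topos HR) U X m /\
  (forall (G : C) (a : Hom G (tt_car X)) (c : R G), c ≤ ap (tt_rel X) a a ->
     c ≤ reidx R a (cl (im HR (rel m)))).
Proof.
assert (K : forall (G : C) (a : Hom G (tt_car X)) (c : R G),
  c ≤ ap (tt_rel X) a a ->
  (c ≤ reidx R a (pred_of (tt_comp cl_j (tt_chi HO m))) <->
   c ≤ reidx R a (cl (im HR (rel m))))).
{ intros G a c H. rewrite (pred_of_cl _ H).
  split; intro K; apply (cl_elim K); intros c' L M; apply cl_intro;
    apply (pred_of_classify HR HO (im_is_pred m)) in M || apply pred_of_classify;
    exact M. }
split.
- intros [Hm E]. split; [exact Hm |]. intros G a c H. apply (K _ _ _ H).
  exact (proj1 (eq_true (tt_comp cl_j (tt_chi HO m)) _) E _ _ _ H).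
- intros [Hm H]. exists Hm.
  apply (eq_true (tt_comp cl_j (tt_chi HO m))). intros G a c L.
  apply (K _ _ _ L), H, L.
Qed.

End Inclusion.

(** * Sheaves *)

(** Preimages of objects and their isomorphisms are chosen; an arrow is sent to the lift of its
    conjugate by these isomorphisms, and faithfulness makes this functorial. *)
Lemma equivalence_of_fully_faithful (S T : category) (F : functor S T) :
  (forall (A B : S) (h : Hom (F A) (F B)), exists f : Hom A B, fmap F f = h) ->
  (forall (A B : S) (f g : Hom A B), fmap F f = fmap F g -> f = g) ->
  (forall Y : T, exists (X : S) (i : Hom (F X) Y), is_iso i) ->
  equivalent_categories T S.
Proof.
intros Hfull Hfaith Hsurj.
destruct (functional_choice _ Hsurj) as [G HG].
assert (HG' : forall Y : T, exists i : Hom (F (G Y)) Y * Hom Y (F (G Y)),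
  snd i ∘ fst i = idm _ /\ fst i ∘ snd i = idm _).
{ intro Y. destruct (HG Y) as (i & k & H). exists (i, k). exact H. }
set (i := fun Y => fst (proj1_sig (constructive_indefinite_description _ (HG' Y)))).
set (k := fun Y => snd (proj1_sig (constructive_indefinite_description _ (HG' Y)))).
assert (Hki : forall Y, k Y ∘ i Y = idm _).
{ intro Y. exact (proj1 (proj2_sig (constructive_indefinite_description _ (HG' Y)))). }
assert (Hik : forall Y, i Y ∘ k Y = idm _).
{ intro Y. exact (proj2 (proj2_sig (constructive_indefinite_description _ (HG' Y)))). }
clearbody i k. clear HG HG'.
set (lift := fun A B (h : Hom (F A) (F B)) =>
  proj1_sig (constructive_indefinite_description _ (Hfull A B h))).
assert (Hl : forall A B (h : Hom (F A) (F B)), fmap F (lift A B h) = h).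
{ intros A B h.
  exact (proj2_sig (constructive_indefinite_description _ (Hfull A B h))). }
clearbody lift.
unshelve eset (G' := @Functor T S G
  (fun A B h => lift (G A) (G B) (k B ∘ h ∘ i A)) _ _).
{ intro A. apply Hfaith. rewrite Hl, fmap_id, comp_idr. apply Hki. }
{ intros A B D g f. apply Hfaith. rewrite fmap_comp, !Hl.
  rewrite !comp_assoc. f_equal. rewrite <- !comp_assoc. f_equal. f_equal.
  rewrite comp_assoc, Hik. symmetry. apply comp_idl. }
exists G', F. split.
- exists i. split.
  + intro Y. exists (k Y). exact (conj (Hki Y) (Hik Y)).
  + intros A B f. simpl. rewrite Hl, !comp_assoc, Hik. f_equal. apply comp_idl.
- exists (fun X => lift (G (F X)) X (i (F X))). split.
  + intro X. exists (lift X (G (F X)) (k (F X))).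
    split; apply Hfaith; rewrite fmap_comp, !Hl, fmap_id; [apply Hki | apply Hik].
  + intros A B f. apply Hfaith. simpl. rewrite !fmap_comp, !Hl.
    rewrite !comp_assoc, Hik. f_equal. apply comp_idl.
Qed.

(** * The functor from T_R to T_P and its restriction to sheaves *)

Section Equivalence.
Variables (C : lex_category) (P R : lex_primary_doctrine C)
  (HP : full_existential P) (HR : full_existential R)
  (HOP : higher_order P) (HO : higher_order R)
  (I : doctrine_inclusion P R).

Definition dl_ob (X : tt_ob R) : tt_ob P.
Proof.
apply (@TTOb C P (tt_car X) (dl I (tt_rel X))).
- rewrite <- dl_reidx. apply (dl_mono I), tt_sym.
- rewrite <- !dl_reidx, <- dl_meet. apply (dl_mono I), tt_trans.
Defined.

Definition di_ob (Y : tt_ob P) : tt_ob R.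
Proof.
apply (@TTOb C R (tt_car Y) (di I (tt_rel Y))).
- rewrite <- di_reidx. apply (di_mono I), tt_sym.
- rewrite <- !di_reidx, <- di_meet. apply (di_mono I), tt_trans.
Defined.

(** The equality is strict because [dl_di] is; properties of an object of T_P thus pass to its copy
    in T_R by rewriting. *)
Lemma dl_di_ob (Y : tt_ob P) : dl_ob (di_ob Y) = Y.
Proof.
destruct Y as [A rho Hs Ht]. unfold dl_ob, di_ob. simpl.
generalize (dl_di I rho).
(* The proof fields depend on the equality predicate and must be generalized before it can be
   rewritten. *)
match goal with |- _ -> TTOb ?s ?t = _ => generalize s t end.
intros s t E. revert s t. rewrite E. intros s t.
f_equal; apply PropExtensionality.proof_irrelevance.
Qed.

Definition dl_hom (X Y : tt_ob R) (f : tt_hom HR X Y) :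
  tt_hom HP (dl_ob X) (dl_ob Y).
Proof.
exists (dl I (rel f)). pose proof (proj2_sig f) as Hf.
constructor; simpl; rewrite <- !dl_reidx, <- ?dl_ex with (HR := HR), <- ?dl_meet;
  apply (dl_mono I); apply Hf.
Defined.

Lemma dl_comp (X Y Z : tt_ob R) (g : tt_hom HR Y Z) (f : tt_hom HR X Y) :
  dl_hom (tt_comp g f) = tt_comp (dl_hom g) (dl_hom f).
Proof.
apply tt_hom_ext. simpl. unfold rel_comp.
rewrite (dl_ex HP), dl_meet, !dl_reidx. reflexivity.
Qed.

Definition dl_functor : functor (tripos_to_topos HR) (tripos_to_topos HP).
Proof.
apply (@Functor (tripos_to_topos HR) (tripos_to_topos HP) dl_ob dl_hom).
- intro X. apply tt_hom_ext. reflexivity.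
- intros X Y Z g f. exact (dl_comp g f).
Defined.

Lemma dl_entailment (A B : C) (x : R (lprd A B)) (y : R A) :
  (forall G a b (c : R G), c ≤ ap x a b -> c ≤ reidx R a y) ->
  forall G a b (c : P G), c ≤ ap (dl I x) a b -> c ≤ reidx P a (dl I y).
Proof.
intros H G a b c K. apply (le_trans _ K). unfold ap. rewrite <- !dl_reidx.
apply dl_mono, (H _ _ b), le_refl.
Qed.

Lemma dl_injective (X Y : tt_ob R) (m : tt_hom HR X Y) :
  @mono (tripos_to_topos HR) X Y m ->
  forall (G : C) (a a' : Hom G (tt_car X)) (b : Hom G (tt_car Y)) (c : P G),
    c ≤ ap (rel (dl_hom m)) a b -> c ≤ ap (rel (dl_hom m)) a' b ->
    c ≤ ap (tt_rel (dl_ob X)) a a'.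
Proof.
intros Hm G a a' b c. apply le_meet2. unfold ap. simpl.
rewrite <- !dl_reidx, <- dl_meet. apply dl_mono.
apply (mono_injective Hm (b := b)); [apply meet_lel | apply meet_ler].
Qed.

Lemma dl_im (X Y : C) (m : R (lprd X Y)) : dl I (im HR m) = im HP (dl I m).
Proof. unfold im, exq, ap. rewrite (dl_ex HP), dl_reidx. reflexivity. Qed.

(** Density says that the closure of the image contains every existing element, so m becomes
    surjective in P while it stays injective; its converse is then an inverse. *)
Lemma dense_inverse (U X : tt_ob R) (m : tt_hom HR U X) :
  dense (E := tt_topos HR HO) (cl_topology HR HO I) m ->
  exists n : tt_hom HP (dl_ob X) (dl_ob U),
    forall (G : C) (a : Hom G (tt_car U)) (b : Hom G (tt_car X)) (c : P G),
      c ≤ ap (rel n) b a <-> c ≤ ap (rel (dl_hom m)) a b.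
Proof.
intro H. apply dense_spec in H. destruct H as [Hm Hd].
destruct (bijective_inverse (f := dl_hom m)) as (n & Hn & _).
- apply dl_injective, Hm.
- intros G b c H. apply (le_trans _ H). unfold ap. simpl.
  rewrite <- dl_im, <- !dl_reidx. apply dl_adj. rewrite dl_reidx, di_reidx.
  apply Hd, le_refl.
- exists n. exact Hn.
Qed.

Lemma dense_im (U X : tt_ob R) (m : tt_hom HR U X) :
  dense (E := tt_topos HR HO) (cl_topology HR HO I) m ->
  forall (G : C) (b : Hom G (tt_car X)) (c : P G),
    c ≤ ap (tt_rel (dl_ob X)) b b -> c ≤ reidx P b (im HP (rel (dl_hom m))).
Proof.
intros H G b c K. destruct (dense_inverse H) as [n Hn].
tot n K. apply Hn in M. exact (im_intro HP M).
Qed.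

(** The third hypothesis says that a and b are related by the closure of the equality of Y. *)
Definition separated (Y : tt_ob R) : Prop :=
  forall (G : C) (a b : Hom G (tt_car Y)) (c : R G),
    c ≤ ap (tt_rel Y) a a -> c ≤ ap (tt_rel Y) b b ->
    dl I c ≤ ap (tt_rel (dl_ob Y)) a b -> c ≤ ap (tt_rel Y) a b.

Lemma ldiag_pi1 (G A : C) (a : Hom G A) : lpi1 A A ∘ (ldiag A ∘ a) = a.
Proof. unfold ldiag. rewrite comp_assoc, lpi1_pair. apply comp_idl. Qed.

Lemma ldiag_pi2 (G A : C) (a : Hom G A) : lpi2 A A ∘ (ldiag A ∘ a) = a.
Proof. unfold ldiag. rewrite comp_assoc, lpi2_pair. apply comp_idl. Qed.

Lemma cl_rel_ext (Y : tt_ob R) : ext_pred (X := tt_prd Y Y) (cl I (tt_rel Y)).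
Proof.
apply cl_ext. intros G z z' c H K. apply tt_prd_spec in H. destruct H as [H1 H2].
apply reidx_ap. apply reidx_ap in K.
exact (tt_rel_trans (tt_rel_sym H1) (tt_rel_trans K H2)).
Qed.

(** Let K be the closure of the diagonal in Y × Y. The diagonal is dense in K and both projections
    of K restrict to the identity along it, so the uniqueness part of the sheaf condition makes them
    equal. *)
Lemma sheaf_separated (Y : tt_ob R) :
  is_sheaf (E := tt_topos HR HO) (cl_topology HR HO I) Y -> separated Y.
Proof.
intros HY G a b c Ha Hb Hab.
set (K := tt_sub (cl_rel_ext (Y := Y))).
assert (Hd : forall G (a b : Hom G (tt_car Y)) (c : R G), c ≤ ap (tt_rel Y) a b ->
  c ≤ ap (tt_rel K) (ldiag _ ∘ a) (ldiag _ ∘ b)).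
{ intros G' x y c' H. unfold ldiag. autorewrite with kj.
  apply tt_sub_spec. split.
  - apply tt_prd_spec. rewrite !lpi1_pair, !lpi2_pair. exact (conj H H).
  - apply (cl_intro I (a := lpair x x)). exact (tt_rel_trans H (tt_rel_sym H)). }
set (d := tt_graph HR Hd : tt_hom HR Y K).
assert (H1 : forall G (x y : Hom G (tt_car K)) (c : R G), c ≤ ap (tt_rel K) x y ->
  c ≤ ap (tt_rel Y) (lpi1 _ _ ∘ x) (lpi1 _ _ ∘ y)).
{ intros G' x y c' H. apply tt_sub_spec, proj1, tt_prd_spec in H. apply H. }
assert (H2 : forall G (x y : Hom G (tt_car K)) (c : R G), c ≤ ap (tt_rel K) x y ->
  c ≤ ap (tt_rel Y) (lpi2 _ _ ∘ x) (lpi2 _ _ ∘ y)).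
{ intros G' x y c' H. apply tt_sub_spec, proj1, tt_prd_spec in H. apply H. }
assert (D1 : forall G (x : Hom G (tt_car Y)) (y : Hom G (tt_car K)) (c : R G),
  c ≤ ap (rel d) x y -> c ≤ ap (tt_rel Y) x (lpi1 _ _ ∘ y)).
{ intros G' x y c' H. apply tt_graph_spec, proj2, H1 in H.
  rewrite <- (ldiag_pi1 x). exact H. }
assert (Dd : dense (E := tt_topos HR HO) (cl_topology HR HO I) d).
{ apply dense_spec. split.
  - apply injective_mono. intros G' x x' y c' H H'.
    apply D1 in H. apply D1 in H'.
    exact (tt_rel_trans H (tt_rel_sym H')).
  - intros G' z c' H. pose proof (proj1 (tt_sub_spec _ _ _ _) H) as [Hz Hc].
    apply (cl_elim Hc). intros c'' L Hc'. shift L. apply cl_intro.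
    apply (im_intro HR (a := lpi1 _ _ ∘ z)).
    apply reidx_ap in Hc'.
    apply tt_graph_spec. split; [exact (H1 _ _ _ _ H) |].
    apply tt_sub_spec. split.
    + apply tt_prd_spec. rewrite ldiag_pi1, ldiag_pi2.
      exact (conj (H1 _ _ _ _ H) Hc').
    + apply cl_intro, reidx_ap. rewrite ldiag_pi1, ldiag_pi2.
      exact (H1 _ _ _ _ H). }
destruct (HY _ _ _ Dd (tt_id HR Y)) as (g & _ & Hg).
assert (E : tt_graph HR H1 = tt_graph HR H2).
{ rewrite <- (Hg (tt_graph HR H1)), <- (Hg (tt_graph HR H2)); [reflexivity | |];
  apply (hom_eq (f := tt_comp _ d)); intros G' x y c' H;
  apply graph_comp_spec, proj2, tt_graph_spec, proj2 in H;
  [rewrite <- (ldiag_pi2 x) | rewrite <- (ldiag_pi1 x)]; exact H. }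
assert (M : c ≤ ap (tt_rel K) (lpair a b) (lpair a b)).
{ apply tt_sub_spec. split.
  - apply tt_prd_spec. cc. rewrite lpi1_pair, lpi2_pair. exact (conj Ha Hb).
  - apply di_at. exact Hab. }
assert (N : c ≤ ap (rel (tt_graph HR H1)) (lpair a b) a).
{ apply tt_graph_spec. split; [exact M |].
  change (c ≤ ap (tt_rel Y) (lpi1 _ _ ∘ lpair a b) a).
  rewrite lpi1_pair. exact Ha. }
rewrite E in N. apply tt_graph_spec, proj2 in N.
change (c ≤ ap (tt_rel Y) (lpi2 _ _ ∘ lpair a b) a) in N.
rewrite lpi2_pair in N. exact (tt_rel_sym N).
Qed.

(** Values of f and g at the same element exist in R and are equal in P, hence equal in R by
    separation. *)
Lemma dl_faithful (X Y : tt_ob R) (f g : tt_hom HR X Y) :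
  separated Y -> dl_hom f = dl_hom g -> f = g.
Proof.
intros HY E. apply hom_eq. intros G a b c H. tot g (hom_strict_l H).
refine (hom_ext_r (HY _ _ _ _ _ _ _) M).
- exact (hom_strict_r M).
- exact (hom_strict_r H).
- apply (dl_ap I) in M. apply (dl_ap I) in H.
  change (dl I c0 ≤ ap (rel (dl_hom f)) (a ∘ p) (b ∘ p)) in H.
  rewrite E in H. exact (hom_single (f := dl_hom g) M H).
Qed.

Lemma dl_full (X Y : tt_ob R) (psi : tt_hom HP (dl_ob X) (dl_ob Y)) :
  is_sheaf (E := tt_topos HR HO) (cl_topology HR HO I) Y ->
  exists f : tt_hom HR X Y, dl_hom f = psi.
Proof.
intro HY. pose proof (sheaf_separated HY) as Hsep.
(* In R the relation ψ is strict only up to closure; the first two conjuncts restore strictness and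
   vanish again in P. *)
set (th := ap (tt_rel X) (lpi1 _ _) (lpi1 _ _) ⊓
  (ap (tt_rel Y) (lpi2 _ _) (lpi2 _ _) ⊓ di I (rel psi))
  : R (lprd (tt_car X) (tt_car Y))).
assert (Th : forall G a b (c : R G), c ≤ ap th a b <->
  c ≤ ap (tt_rel X) a a /\ c ≤ ap (tt_rel Y) b b /\ dl I c ≤ ap (rel psi) a b).
{ intros G a b c. unfold th, ap. rewrite !reidx_meet, !le_meet_iff, di_at.
  autorewrite with kj. reflexivity. }
assert (Tp : rel psi ≤ dl I th).
{ apply rel_ext_le. intros G a b c H. unfold th, ap.
  rewrite !dl_meet, !dl_reidx, dl_di. rewrite !reidx_meet.
  autorewrite with kj. repeat apply meet_glb.
  - exact (hom_strict_l H).
  - exact (hom_strict_r H).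
  - exact H. }
assert (Tl : forall G a a' b (c : R G), c ≤ ap (tt_rel X) a a' -> c ≤ ap th a b ->
  c ≤ ap th a' b).
{ intros G a a' b c H K. apply Th in K. destruct K as (K1 & K2 & K3).
  apply Th. split; [exact (tt_rel_trans (tt_rel_sym H) H) |]. split; [exact K2 |].
  exact (hom_ext_l (f := psi) (dl_ap I H) K3). }
assert (De : ext_pred (X := X) (exq HR th)).
{ intros G a a' c H K. elimq (exq_elim K). apply (exq_intro HR (b := y)).
  exact (Tl _ _ _ _ _ H H0). }
set (i := tt_incl HR De).
(* The domain on which [th] has witnesses is dense because ψ is total in P and [dl] preserves ∃. *)
assert (Dd : dense (E := tt_topos HR HO) (cl_topology HR HO I) i).
{ apply dense_spec. split.
  - apply injective_mono. intros G a a' b c H H'.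
    apply tt_incl_spec in H. apply tt_incl_spec in H'. apply tt_sub_spec.
    split; [| apply H]. exact (tt_rel_trans (proj1 H) (tt_rel_sym (proj1 H'))).
  - intros G a c H. apply di_at.
    pose proof (dl_ap I H) as K. tot psi K.
    refine (@dl_entailment _ _ th _ _ _ _ y _ _).
    + intros G1 a1 b1 c1 H1. apply (im_intro HR (a := a1)).
      apply tt_incl_spec. split; [| exact (exq_intro HR H1)].
      apply Th in H1. apply H1.
    + apply (le_trans _ M). apply reidx_mono, Tp. }
assert (Hf : is_tt_arrow HR (X := tt_sub De) (Y := Y) th).
{ apply is_tt_arrow_intro.
  - intros G a b c H. apply tt_sub_spec. split; [| exact (exq_intro HR H)].
    apply Th in H. apply H.
  - intros G a b c H. apply Th in H. apply H.
  - intros G a a' b c H K. apply tt_sub_spec in H. exact (Tl _ _ _ _ _ (proj1 H) K).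
  - intros G a b b' c H K. apply Th in K. destruct K as (K1 & K2 & K3).
    apply Th. split; [exact K1 |]. split; [exact (tt_rel_trans (tt_rel_sym H) H) |].
    exact (hom_ext_r (f := psi) (dl_ap I H) K3).
  - intros G a b b' c H K. apply Th in H. apply Th in K. apply Hsep.
    + apply H.
    + apply K.
    + exact (hom_single (f := psi) (proj2 (proj2 H)) (proj2 (proj2 K))).
  - intros G a c H. apply tt_sub_spec in H. apply H. }
destruct (HY _ _ _ Dd (exist _ th Hf : tt_hom HR (tt_sub De) Y)) as (g & Eg & _).
(* It suffices that ψ is contained in the image of g: ψ ≤ [dl I th], and [th] is contained in g,
   which extends it along i. *)
exists g. symmetry. apply hom_eq. intros G a b c H.
apply (le_trans _ H). apply reidx_mono. apply (le_trans _ Tp).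
apply (dl_mono I). apply rel_ext_le. intros G' a' b' c' K.
change th with (rel (exist _ th Hf : tt_hom HR (tt_sub De) Y)) in K.
rewrite <- Eg in K. change (g ∘ i) with (tt_comp g i) in K.
elimq (comp_elim (f := i) (g := g) K).
apply tt_incl_spec, proj1 in H0. exact (hom_ext_l (f := g) (tt_rel_sym H0) H1).
Qed.

Definition weakly_complete (Y : tt_ob P) : Prop :=
  forall (Z : tt_ob P) (psi : tt_hom HP Z Y),
    exists g : Hom (tt_car Z) (tt_car Y),
      forall G (z : Hom G (tt_car Z)) (y : Hom G (tt_car Y)) (c : P G),
        c ≤ ap (rel psi) z y -> c ≤ ap (tt_rel Y) (g ∘ z) y.

(** In P the dense m is invertible, so f extends along it to a functional relation, which an arrow g
    of C tracks. The equality of F being closed, g preserves equality already in R, and its graph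
    there is the extension. *)
Lemma weakly_complete_sheaf (F : tt_ob R) :
  (forall G (a b : Hom G (tt_car F)) (c : R G),
     dl I c ≤ ap (tt_rel (dl_ob F)) a b -> c ≤ ap (tt_rel F) a b) ->
  weakly_complete (dl_ob F) ->
  is_sheaf (E := tt_topos HR HO) (cl_topology HR HO I) F.
Proof.
intros Hcl Hwc U X m Hm f.
destruct (dense_inverse Hm) as [n Hn].
destruct (Hwc _ (tt_comp (dl_hom f) n)) as [g Hg].
assert (Kg : forall G (a b : Hom G (tt_car X)) (c : R G),
  c ≤ ap (tt_rel X) a b -> c ≤ ap (tt_rel F) (g ∘ a) (g ∘ b)).
{ intros G a b c H. apply Hcl. pose proof (dl_ap I H) as K.
  pose proof (tt_rel_trans (X := dl_ob X) K (tt_rel_sym (X := dl_ob X) K)) as K'.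
  tot (tt_comp (dl_hom f) n) K'.
  pose proof (hom_ext_l (f := tt_comp (dl_hom f) n) K M) as N.
  apply Hg in M. apply Hg in N. kj.
  exact (tt_rel_trans (X := dl_ob F) M (tt_rel_sym (X := dl_ob F) N)). }
exists (tt_graph HR Kg : tt_hom HR X F). split.
- symmetry. apply hom_eq. intros G u y c H.
  tot m (hom_strict_l H).
  apply (comp_intro M). apply tt_graph_spec. split; [exact (hom_strict_r M) |].
  apply Hcl. apply Hg. apply (comp_intro (f := n) (b := u ∘ p)).
  + apply Hn. exact (dl_ap I M).
  + exact (dl_ap I H).
- intros h Eh. symmetry. apply hom_eq. intros G x y c H.
  apply tt_graph_spec. split; [exact (hom_strict_l H) |].
  apply Hcl. apply Hg.
  (* In P the element x comes from some u in U, where h and f agree; as the equality of F is closed,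
     h(x) is also g(x) in R. *)
  pose proof (dense_im Hm (dl_ap I (hom_strict_l H))) as K.
  apply (dl_ap I) in H.
  elimq (im_elim K). apply (comp_intro (f := n) (b := y0)); [apply Hn; exact H0 |].
  rewrite <- Eh. change (h ∘ m) with (tt_comp h m). rewrite dl_comp.
  exact (comp_intro (f := dl_hom m) (g := dl_hom h) H0 H).
Qed.

(** * Objects of singletons *)

Section Singletons.
Variable Y : tt_ob P.

Lemma tt_rel_is_pred : is_pred (X := tt_prd Y Y) (tt_rel Y).
Proof.
split.
- intros G z c H. apply reidx_ap in H. apply tt_prd_spec.
  exact (conj (tt_rel_trans H (tt_rel_sym H)) (tt_rel_trans (tt_rel_sym H) H)).
- intros G z z' c H K. apply tt_prd_spec in H. destruct H as [H1 H2].
  apply reidx_ap. apply reidx_ap in K.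
  exact (tt_rel_trans (tt_rel_sym H1) (tt_rel_trans K H2)).
Qed.

Definition singleton : tt_hom HP Y (tt_pow HP HOP Y) :=
  transpose HP HOP tt_rel_is_pred.

Lemma singleton_spec (G : C) (b a : Hom G (tt_car Y)) U (c : P G) :
  c ≤ ap (rel singleton) a U -> (c ≤ ap (pmem HP HOP Y) b U <-> c ≤ ap (tt_rel Y) b a).
Proof. intro H. exact (transpose_at (A := Y) (D := tt_rel Y) b H). Qed.

Lemma singleton_injective (G : C) (a a' : Hom G (tt_car Y)) U (c : P G) :
  c ≤ ap (rel singleton) a U -> c ≤ ap (rel singleton) a' U ->
  c ≤ ap (tt_rel Y) a a'.
Proof.
intros H K. apply (singleton_spec _ K). apply (singleton_spec _ H).
exact (hom_strict_l H).
Qed.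

Definition singletons : tt_ob P := tt_sub (im_ext (m := singleton)).

Lemma singletons_iso :
  exists i : tt_hom HP singletons Y, @is_iso (tripos_to_topos HP) singletons Y i.
Proof.
set (s := tt_lift (im_ext (m := singleton)) (f := singleton)
  (fun _ _ _ _ H => im_intro HP H) : tt_hom HP Y singletons).
destruct (bijective_inverse (f := s)) as (i & _ & E1 & E2).
- exact singleton_injective.
- intros G b c H. apply tt_sub_spec in H. apply H.
- exists i, s. split; assumption.
Qed.

(** The relation D(b, z) says that b belongs to the value of ψ at z. An arrow d naming D tracks ψ,
    because equality in the power object is extensional. *)
Lemma singletons_weakly_complete : weakly_complete singletons.
Proof.
intros Z psi.
set (D := exq HP (ap (rel psi) (lpi2 _ _ ∘ lpi1 _ _) (lpi2 _ _) ⊓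
   ap (pmem HP HOP Y) (lpi1 _ _ ∘ lpi1 _ _) (lpi2 _ _))
  : P (lprd (tt_car Y) (tt_car Z))).
assert (Di : forall G (b : Hom G (tt_car Y)) z U (c : P G),
  c ≤ ap (rel psi) z U -> c ≤ ap (pmem HP HOP Y) b U -> c ≤ ap D b z).
{ intros G b z U c H K. apply (exq_intro HP (b := U)). cc. kj; assumption. }
assert (De : forall G (b : Hom G (tt_car Y)) z U (c : P G),
  c ≤ ap (rel psi) z U -> c ≤ ap D b z -> c ≤ ap (pmem HP HOP Y) b U).
{ intros G b z U c H K. elimq (exq_elim K). cc. kj.
  pose proof (hom_single (f := psi) H0 H) as M.
  apply tt_sub_spec, proj1 in M. exact (tt_pow_elim M H1). }
destruct (pmem_name HP HOP (B := Y) (D := D)) as [d Hd].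
- intros G b z c H. elimq (exq_elim H). cc. kj. exact (pmem_strict H1).
- intros G b b' z c H K. elimq (exq_elim K). cc. kj.
  apply (Di _ _ _ y); [exact H0 | exact (pmem_ext H H1)].
- exists d. intros G z U c H.
  assert (M : c ≤ ap (tt_rel (tt_pow HP HOP Y)) U (d ∘ z)).
  { apply tt_pow_spec. intros G' p b c' L. rewrite <- comp_assoc, Hd.
    shift L. split; [exact (Di _ _ _ _ _ H) | exact (De _ _ _ _ _ H)]. }
  apply (tt_rel_sym (X := singletons)). apply tt_sub_spec. split; [exact M |].
  pose proof (hom_strict_r H) as K. apply tt_sub_spec in K. apply K.
Qed.

End Singletons.

Lemma exists_sheaf (Y : tt_ob P) :
  exists X : tt_ob R, is_sheaf (E := tt_topos HR HO) (cl_topology HR HO I) X /\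
    exists i : tt_hom HP (dl_ob X) Y, @is_iso (tripos_to_topos HP) (dl_ob X) Y i.
Proof.
exists (di_ob (singletons Y)). split.
- apply weakly_complete_sheaf.
  + intros G a b c H. apply di_at.
    change (dl I c ≤ ap (dl I (di I (tt_rel (singletons Y)))) a b) in H.
    rewrite dl_di in H. exact H.
  + rewrite dl_di_ob. apply singletons_weakly_complete.
- rewrite dl_di_ob. apply singletons_iso.
Qed.

Theorem tripos_to_topos_sheaves :
  equivalent_categories (tripos_to_topos HP)
    (sheaves (E := tt_topos HR HO) (cl_topology HR HO I)).
Proof.
set (S := sheaves (E := tt_topos HR HO) (cl_topology HR HO I)).
set (F := @Functor S (tripos_to_topos HP) (fun X => dl_functor (proj1_sig X))
  (fun X Y f => fmap dl_functor f)
  (fun X => fmap_id dl_functor (proj1_sig X))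
  (fun X Y Z g f => fmap_comp dl_functor g f)).
apply (@equivalence_of_fully_faithful S (tripos_to_topos HP) F).
- intros [X HX] [Y HY] h. exact (dl_full h HY).
- intros [X HX] [Y HY] f g E. exact (dl_faithful (sheaf_separated HY) E).
- intro Y. destruct (exists_sheaf Y) as (X & HX & i & Hi).
  exists (exist _ X HX), i. exact Hi.
Qed.

End Equivalence.

(** * The existential completion *)

(** The topos structure is data, whereas the hypotheses only assert existence, hence the choices. *)
Definition higher_order_of_adjoints (C : lex_category) (R : lex_primary_doctrine C) :
  (forall (A B : C) (g : Hom B A) (x y : R B), exists u : R A,
     forall z : R A, z ≤ u <-> reidx R g z ⊓ x ≤ y) ->
  weak_power_objects R -> higher_order R.
Proof.
intros Hfa Hpow.
set (f := fun A B g x y =>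
  constructive_indefinite_description _ (Hfa A B g x y)).
assert (Hpow' : forall X : C, exists m : {PX : C & R (lprd X PX)},
  forall (Y : C) (b : R (lprd X Y)), exists d : Hom Y (projT1 m),
    b = reidx R (lprd_map (idm X) d) (projT2 m)).
{ intro X. destruct (Hpow X) as (PX & m & H). exists (existT _ PX m). exact H. }
set (w := fun X => constructive_indefinite_description _ (Hpow' X)).
exact (@HigherOrder C R (fun A B g x y => proj1_sig (f A B g x y))
  (fun A B g x y => proj2_sig (f A B g x y))
  (fun X => projT1 (proj1_sig (w X))) (fun X => projT2 (proj1_sig (w X)))
  (fun X => proj2_sig (w X))).
Defined.

Definition full_tripos_higher_order (C : lex_category) (P : lex_primary_doctrine C) :
  full_tripos P -> higher_order P.
Proof.
intro HP. apply higher_order_of_adjoints; [| exact (tripos_weak_power HP)].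
intros A B g x y. exists (all HP g (imp (fo_heyting HP B) x y)).
intro z. rewrite all_adj. apply imp_adj.
Defined.

Section Completion.
Variables (C : lex_category) (P : lex_primary_doctrine C).

Lemma pullback_sym (K : category) (A B D E : K) (f : Hom A D) (g : Hom B D)
    (p : Hom E A) (q : Hom E B) :
  is_pullback f g p q -> is_pullback g f q p.
Proof.
intros [E1 U]. split; [symmetry; exact E1 |].
intros X a b H. destruct (U X b a (eq_sym H)) as (u & [U1 U2] & U3).
exists u. split; [exact (conj U2 U1) |]. intros v [V1 V2]. exact (U3 v (conj V2 V1)).
Qed.

Lemma meet_comm (L : inf_semilattice) (x y : L) : x ⊓ y = y ⊓ x.
Proof.
apply le_antisym; apply meet_glb; first [apply meet_ler | apply meet_lel].
Qed.

Section Inclusion.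
Variable HP : full_existential P.

Lemma ex_id (A : C) (x : P A) : ex HP (idm A) x = x.
Proof.
apply le_antisym.
- apply ex_adj. rewrite reidx_id. apply le_refl.
- rewrite <- (reidx_id (ex HP (idm A) x)). apply (ex_adj HP), le_refl.
Qed.

Lemma ex_comp (A B D : C) (g : Hom B D) (f : Hom A B) (x : P A) :
  ex HP (g ∘ f) x = ex HP g (ex HP f x).
Proof.
apply le_antisym.
- apply ex_adj. rewrite reidx_comp. do 2 apply (proj1 (ex_adj HP _ _ _)). apply le_refl.
- apply ex_adj, ex_adj. rewrite <- reidx_comp. apply (ex_adj HP), le_refl.
Qed.

(** A representative is chosen; [exc_val_cls] shows that the value does not depend on it. *)
Definition exc_val (A : C) (s : exc_fib P A) : P A :=
  let q := proj1_sig (constructive_indefinite_description _ (cls_surj s)) in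
  ex HP (exc_map q) (exc_pred q).

(** An arrow over A from (f, α) to (id, y) can only be f itself, so the order on the right says α ≤
    P_f(y), that is ∃_f α ≤ y. *)
Lemma exc_val_cls_le (A : C) (q : exc_preorder P A) (y : P A) :
  exc_val (cls q) ≤ y <->
  @le (exc_fib P A) (cls q) (cls (ExcElem (idm A) y : exc_preorder P A)).
Proof.
unfold exc_val.
destruct (constructive_indefinite_description _ (cls_surj (cls q))) as [r E].
simpl proj1_sig. rewrite E. simpl. rewrite refl_le_cls, ex_adj. simpl.
split.
- intro H. exists (exc_map r). simpl. rewrite comp_idl. exact (conj eq_refl H).
- intros (h & H & K). simpl in *. rewrite H, comp_idl. exact K.
Qed.

Lemma exc_val_cls (A : C) (q : exc_elem P A) :
  exc_val (cls (q : exc_preorder P A)) = ex HP (exc_map q) (exc_pred q).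
Proof.
assert (K : forall y, exc_val (cls (q : exc_preorder P A)) ≤ y <->
  ex HP (exc_map q) (exc_pred q) ≤ y).
{ intro y. rewrite exc_val_cls_le. simpl. rewrite refl_le_cls, ex_adj. split.
  - intros (h & H & K). simpl in *. rewrite H, comp_idl. exact K.
  - intro H. exists (exc_map q). simpl. rewrite comp_idl. exact (conj eq_refl H). }
apply le_antisym; apply K, le_refl.
Qed.

Definition completion_inclusion : doctrine_inclusion P (existential_completion P).
Proof.
apply (@DoctrineInclusion C P (existential_completion P) exc_val
  (fun A y => cls (ExcElem (idm A) y : exc_preorder P A))).
- intros A s y. destruct (cls_surj s) as [q ->]. apply exc_val_cls_le.
- intros A y. rewrite exc_val_cls. apply ex_id.
- intros A s t. destruct (cls_surj s) as [q ->], (cls_surj t) as [r ->].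
  simpl. rewrite refl_meet_cls. simpl. rewrite !exc_val_cls. simpl.
  (* With p, q the projections of the pullback of f and g: ∃_f ∃_p(p^*a ∧ q^*b) = ∃_f(a ∧ ∃_p q^*b)
     = ∃_f(a ∧ f^*∃_g b) = ∃_f a ∧ ∃_g b, by Frobenius, Beck-Chevalley and Frobenius. *)
  rewrite ex_comp, meet_comm, ex_frobenius.
  rewrite <- (ex_beck_chevalley HP (pullback_sym (lpb_is_pullback _ _))), meet_comm.
  apply ex_frobenius.
- intros A B f s. destruct (cls_surj s) as [q ->].
  simpl. unfold exc_reidx. rewrite refl_lift_cls, !exc_val_cls. simpl.
  symmetry. apply ex_beck_chevalley, pullback_sym, lpb_is_pullback.
- intros A B f y. simpl. unfold exc_reidx. rewrite refl_lift_cls. apply cls_eq.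
  split.
  + apply exc_reidx0_le. exists f. simpl.
    rewrite comp_idl, comp_idr. split; [reflexivity | apply le_refl].
  + exists (lpb1 f (idm B)). simpl. split; [symmetry; apply comp_idl |].
    rewrite <- reidx_comp, (proj1 (lpb_is_pullback f (idm B))), comp_idl.
    apply le_refl.
Defined.

End Inclusion.

(** * Quantifiers and power objects from the category of points *)

Definition pt (A : C) (a : P A) : category_of_points P := existT _ A a.

Definition pt_arrow (A B : C) (a : P A) (b : P B) (f : Hom A B)
    (H : a ≤ reidx P f b) : Hom (pt a) (pt b) := exist _ f H.

Definition under (X Y : category_of_points P) (f : Hom X Y) :
  Hom (projT1 X) (projT1 Y) := proj1_sig f.

Lemma under_le (X Y : category_of_points P) (f : Hom X Y) :
  projT2 X ≤ reidx P (under f) (projT2 Y).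
Proof. exact (proj2_sig f). Qed.

Lemma pt_is_pullback (X Y Z E : category_of_points P) (f : Hom X Z) (g : Hom Y Z)
    (p : Hom E X) (q : Hom E Y) :
  is_pullback (under f) (under g) (under p) (under q) ->
  reidx P (under p) (projT2 X) ⊓ reidx P (under q) (projT2 Y) ≤ projT2 E ->
  is_pullback f g p q.
Proof.
intros [E1 U] H. split; [apply pt_hom_ext; exact E1 |].
intros W a b Eab.
destruct (U _ (under a) (under b) (f_equal (@under W Z) Eab))
  as (u & [U1 U2] & U3).
assert (Hu : projT2 W ≤ reidx P u (projT2 E)).
{ apply (fun h => le_trans _ h (reidx_mono u H)).
  rewrite reidx_meet, <- !reidx_comp, U1, U2.
  apply meet_glb; apply under_le. }
exists (exist _ u Hu). split.
- split; apply pt_hom_ext; assumption.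
- intros v [<- <-]. apply pt_hom_ext. apply U3. split; reflexivity.
Qed.

Lemma exc_le_iff (A : C) (x y : exc_elem P A) :
  exc_le x y <-> exists h : Hom (pt (exc_pred x)) (pt (exc_pred y)),
    exc_map x = exc_map y ∘ under h.
Proof.
split.
- intros (h & H & K). exists (pt_arrow K). exact H.
- intros [h H]. exists (under h). exact (conj H (under_le h)).
Qed.

(** Let s be (f, a) and t be (k, b). Implication from s is pullback along f followed by the product
    along f, so ∀_g(s → t) is a single dependent product of f^*t along g ∘ f. A weak one suffices,
    since the order of the fibre only asks that an arrow exist. *)
Lemma completion_fa :
  has_weak_dependent_products (category_of_points P) ->
  forall (A B : C) (g : Hom B A) (s t : existential_completion P B),
    exists u : existential_completion P A, forall z : existential_completion P A,
      z ≤ u <-> reidx (existential_completion P) g z ⊓ s ≤ t.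
Proof.
intros HW A B g s t.
destruct (cls_surj s) as [x ->], (cls_surj t) as [y ->].
destruct x as [D f a], y as [E k b].
set (XE := pt (reidx P (lpb1 f k) a ⊓ reidx P (lpb2 f k) b)).
set (pr := pt_arrow (meet_lel (reidx P (lpb1 f k) a) (reidx P (lpb2 f k) b))
  : Hom XE (pt a)).
assert (Hg : a ≤ reidx P (g ∘ f) (top : P A)).
{ rewrite reidx_top. apply le_top. }
destruct (HW _ _ _ pr (pt_arrow Hg)) as (Z & E' & h & p & q & e & Hpb & He & Hu).
exists (cls (ExcElem (under h) (projT2 Z) : exc_preorder P A)).
intro z. destruct (cls_surj z) as [[W m c] ->].
set (Q := lpb m (g ∘ f)).
set (cq := reidx P (lpb1 m (g ∘ f)) c ⊓ reidx P (lpb2 m (g ∘ f)) a : P Q).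
assert (Em : m ∘ lpb1 m (g ∘ f) = g ∘ f ∘ lpb2 m (g ∘ f)) by apply lpb_is_pullback.
(* g^*z ∧ s is an iterated pullback; it is replaced by the pullback of m and g ∘ f, which is what
   the dependent product speaks about. *)
assert (M : reidx (existential_completion P) g
    (cls (ExcElem m c : exc_preorder P A)) ⊓ cls (ExcElem f a : exc_preorder P B) =
  cls (ExcElem (f ∘ lpb2 m (g ∘ f)) cq : exc_preorder P B)).
{ apply le_antisym.
  - simpl. unfold exc_reidx. rewrite refl_lift_cls, refl_meet_cls.
    apply refl_le_cls. simpl.
    destruct (lpb_is_pullback g m) as [E1 _].
    destruct (lpb_is_pullback (lpb1 g m) f) as [E2 _].
    destruct (lpb_is_pullback m (g ∘ f)) as [_ U].
    destruct (U _ (lpb2 g m ∘ lpb1 (lpb1 g m) f) (lpb2 (lpb1 g m) f))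
      as (u & [U1 U2] & _).
    { rewrite comp_assoc, <- E1, <- !comp_assoc, E2. reflexivity. }
    exists u. simpl. split.
    + rewrite <- comp_assoc, U2. exact E2.
    + unfold cq. rewrite reidx_meet, <- !reidx_comp.
      change (reidx P (lpb2 g m ∘ lpb1 (lpb1 g m) f) c ⊓
        reidx P (lpb2 (lpb1 g m) f) a ≤
        reidx P (lpb1 m (g ∘ f) ∘ u) c ⊓ reidx P (lpb2 m (g ∘ f) ∘ u) a).
      rewrite U1, U2. apply le_refl.
  - apply meet_glb.
    + apply exc_adj. simpl. unfold exc_ex. rewrite refl_lift_cls.
      apply refl_le_cls. exists (lpb1 m (g ∘ f)). simpl.
      split; [rewrite comp_assoc; symmetry; exact Em | apply meet_lel].
    + apply refl_le_cls. exists (lpb2 m (g ∘ f)).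
      split; [reflexivity | apply meet_ler]. }
rewrite M. simpl. rewrite !refl_le_cls. simpl. rewrite !exc_le_iff. simpl.
split.
- intros [v Ev].
  set (pa := pt_arrow (meet_ler (reidx P (lpb1 m (g ∘ f)) c)
    (reidx P (lpb2 m (g ∘ f)) a)) : Hom (pt cq) (pt a)).
  set (pc := pt_arrow (meet_lel (reidx P (lpb1 m (g ∘ f)) c)
    (reidx P (lpb2 m (g ∘ f)) a)) : Hom (pt cq) (pt c)).
  (* v induces an arrow from Q to E', and the evaluation e carries it on to f^*t. *)
  destruct (proj2 Hpb _ pa ((v : Hom (pt c) Z) ∘ pc)) as (n & [N1 N2] & _).
  { apply pt_hom_ext.
    change (g ∘ f ∘ lpb2 m (g ∘ f) = under h ∘ (under v ∘ lpb1 m (g ∘ f))).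
    rewrite comp_assoc, <- Em. exact (f_equal (fun r => r ∘ lpb1 m (g ∘ f)) Ev). }
  set (pb' := pt_arrow (meet_ler (reidx P (lpb1 f k) a) (reidx P (lpb2 f k) b))
    : Hom XE (pt b)).
  exists (pb' ∘ (e ∘ n)).
  change (f ∘ lpb2 m (g ∘ f) = k ∘ (lpb2 f k ∘ under (e ∘ n))).
  rewrite comp_assoc, <- (proj1 (lpb_is_pullback f k)), <- comp_assoc. f_equal.
  change (under pa = under (pr ∘ (e ∘ n))).
  rewrite comp_assoc, He, N1. reflexivity.
- intros [v Ev].
  destruct (lpb_is_pullback f k) as [_ U].
  destruct (U _ (lpb2 m (g ∘ f)) (under v) Ev) as (u & [U1 U2] & _).
  assert (Hc : c ≤ reidx P m (top : P A)).
  { rewrite reidx_top. apply le_top. }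
  assert (Hu' : cq ≤ reidx P u (projT2 XE)).
  { simpl. rewrite reidx_meet, <- !reidx_comp.
    apply meet_glb.
    - change (cq ≤ reidx P (lpb1 f k ∘ u) a). rewrite U1. apply meet_ler.
    - change (cq ≤ reidx P (lpb2 f k ∘ u) b). rewrite U2. apply (under_le v). }
  (* Conversely, an arrow from Q to t over B gives Q → f^*t, which makes z a competitor of the weak
     dependent product. *)
  destruct (Hu (pt c) (pt cq) (pt_arrow Hc) (pt_arrow (meet_ler _ _))
    (pt_arrow (meet_lel _ _)) (pt_arrow Hu')) as (w & Ew & _).
  + apply pt_is_pullback.
    * apply pullback_sym, lpb_is_pullback.
    * simpl. apply meet_glb; [apply meet_ler | apply meet_lel].
  + apply pt_hom_ext. exact U1.
  + exists w. exact (f_equal (@under _ _) Ew).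
Qed.

Lemma pt_top_le (A B : C) (a : P A) (f : Hom A B) : a ≤ reidx P f (top : P B).
Proof. rewrite reidx_top. apply le_top. Qed.

Definition pt_top_arrow (X : category_of_points P) (B : C) (f : Hom (projT1 X) B) :
  Hom X (pt (top : P B)) := exist _ f (pt_top_le (projT2 X) f).

Lemma prd_is_pullback (A B : C) :
  is_pullback (lto_one A) (lto_one B) (lpi1 A B) (lpi2 A B).
Proof.
split.
- etransitivity; [| symmetry]; apply to_one_uniq.
- intros X a b _. exists (lpair a b). split.
  + exact (conj (lpi1_pair a b) (lpi2_pair a b)).
  + intros u [<- <-]. rewrite <- lpair_comp, lpair_eta. apply comp_idl.
Qed.

(* The generic proof classifies the elements of every fibre by arrows into the
   object under its codomain; weak exponentials then give weak power objects. *)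
Lemma generic_proof_classifies (Th La : category_of_points P) (theta : Hom Th La) :
  is_generic_proof theta ->
  forall (Y : C) (s : existential_completion P Y),
    exists v : Hom (pt (top : P Y)) La,
      s = reidx (existential_completion P) (under v)
            (cls (ExcElem (under theta) (projT2 Th) : exc_preorder P _)).
Proof.
intros Hg Y s. destruct (cls_surj s) as [[B k b] ->].
(* The arrow k and the pullback of θ factor through each other, which is equality in the poset
   reflection. *)
destruct (Hg _ _ (pt_top_arrow (X := pt b) k))
  as (v & E & p & q & [Ep U] & [s Hs] & [t Ht]).
exists v. simpl. unfold exc_reidx. rewrite refl_lift_cls. apply cls_eq. split.
- apply exc_reidx0_le. apply exc_le_iff. exists (q ∘ s). simpl.
  change (under v ∘ under (pt_top_arrow (X := pt b) k) = under (theta ∘ (q ∘ s))).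
  rewrite Hs, comp_assoc, <- Ep, <- comp_assoc. reflexivity.
- apply exc_le_iff. simpl.
  (* Reindexing uses the pullback of C, the generic proof one in the category of points; u compares
     the two. *)
  set (W := pt (reidx P (lpb2 (under v) (under theta)) (projT2 Th))).
  destruct (U W (pt_top_arrow (X := W) (lpb1 _ _))
    (exist _ (lpb2 _ _) (le_refl _))) as (u & [U1 _] & _).
  { apply pt_hom_ext. exact (proj1 (lpb_is_pullback _ _)). }
  exists (t ∘ u).
  change (under (pt_top_arrow (X := W) (lpb1 (under v) (under theta))) =
    under (pt_top_arrow (X := pt b) k ∘ (t ∘ u))).
  rewrite comp_assoc, <- Ht, U1. reflexivity.
Qed.

(** Z is a weak exponential of (L, l) by (X, ⊤), obtained as the weak dependent product of X × L → X
    along X → 1. Membership is the generic element reindexed along evaluation, and the name of an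
    element comes from weakly transposing its classifying arrow. *)
Lemma completion_weak_power :
  ex_supercompactifiable P -> weak_power_objects (existential_completion P).
Proof.
intros [HW (Th & [L l] & theta & Hg)] X.
pose proof (generic_proof_classifies Hg) as Hc. clear Hg.
set (gn := cls (ExcElem (under theta) (projT2 Th) : exc_preorder P L)
  : existential_completion P L) in *.
set (XL := pt (reidx P (lpi2 X L) l)).
destruct (HW _ _ _ (pt_top_arrow (X := XL) (lpi1 X L))
  (pt_top_arrow (X := pt (top : P X)) (lto_one X)))
  as (Z & E & h & p & q & e & Hpb & He & Hu).
(* The predicate of Z only decorates this point: its underlying object is the full product, so the
   arrow under evaluation is defined on all of it. *)
set (XZ := pt (reidx P (lpi2 X (projT1 Z)) (projT2 Z))).
destruct (proj2 Hpb XZ (pt_top_arrow (X := XZ) (lpi1 _ _))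
  (exist _ (lpi2 _ _) (le_refl _))) as (n & [N1 N2] & _).
{ apply pt_hom_ext. etransitivity; [| symmetry]; apply to_one_uniq. }
exists (projT1 Z), (reidx (existential_completion P)
  (lpi2 X L ∘ under (e ∘ n)) gn).
intros Y b. destruct (Hc _ b) as [v ->].
set (XY := pt (top : P (lprd X Y))).
assert (Hv : projT2 XY ≤ reidx P (lpair (lpi1 X Y) (under v)) (projT2 XL)).
{ simpl. rewrite <- reidx_comp, lpi2_pair. exact (under_le v). }
destruct (Hu (pt (top : P Y)) XY (pt_top_arrow (X := pt (top : P Y)) (lto_one Y))
  (pt_top_arrow (X := XY) (lpi1 X Y)) (pt_top_arrow (X := XY) (lpi2 X Y))
  (pt_arrow Hv)) as (w & _ & kk & K1 & K2 & K3).
- apply pt_is_pullback; [apply prd_is_pullback | apply le_top].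
- apply pt_hom_ext. apply lpi1_pair.
- exists (under w). rewrite <- reidx_comp. f_equal.
  assert (Hw : projT2 XY ≤ reidx P (lprd_map (idm X) (under w)) (projT2 XZ)).
  { simpl. unfold lprd_map. rewrite <- reidx_comp, lpi2_pair, reidx_comp.
    rewrite <- (reidx_top P (lpi2 X Y)). apply reidx_mono. exact (under_le w). }
  set (g := pt_arrow Hw : Hom XY XZ).
  (* Both arrows into the pullback E have the same projections. *)
  assert (Ek : n ∘ g = kk).
  { destruct (proj2 Hpb XY (p ∘ kk) (q ∘ kk)) as (u & _ & Uu).
    - rewrite !comp_assoc, (proj1 Hpb). reflexivity.
    - rewrite <- (Uu kk (conj eq_refl eq_refl)). symmetry. apply Uu.
      rewrite !comp_assoc, N1, N2, K1, K2. split; apply pt_hom_ext.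
      + simpl. unfold lprd_map. rewrite lpi1_pair. apply comp_idl.
      + simpl. unfold lprd_map. apply lpi2_pair. }
  change (under v = lpi2 X L ∘ under (e ∘ n) ∘ under g).
  rewrite <- comp_assoc.
  change (under v = lpi2 X L ∘ under (e ∘ n ∘ g)).
  rewrite <- comp_assoc, Ek, <- K3.
  symmetry. apply lpi2_pair.
Qed.

End Completion.

Theorem corollary8p2 (C : lex_category) (P : lex_primary_doctrine C)
    (HP : full_tripos P) (HS : ex_supercompactifiable P) :
  exists (E : elementary_topos
           (tripos_to_topos (existential_completion_ex P)))
         (j : lawvere_tierney E),
    equivalent_categories (tripos_to_topos HP) (sheaves j).
Proof.
pose proof (higher_order_of_adjoints (completion_fa (proj1 HS))
  (completion_weak_power HS)) as HO.
exists (tt_topos (existential_completion_ex P) HO).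
exists (cl_topology _ HO (completion_inclusion HP)).
exact (tripos_to_topos_sheaves HP _ (full_tripos_higher_order HP) HO _).
Qed.
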